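(* For every integer $d\ge 3$ there exist infinitely many (pairwise non-isomorphic) $(d,d)$-regular right-sided Ramanujan hypergraphs; and for every prime power $d$ there exist infinitely many $(d+1,d)$-regular right-sided Ramanujan hypergraphs.
   Context: A hypergraph $H=(V,E)$ has a finite vertex set and a finite family of subsets of $V$ (edges). It is $(d,r)$-regular if every edge has exactly $r$ vertices and every vertex lies in exactly $d$ edges. The adjacency matrix $A(H)$ has $(u,v)$-entry the number of edges containing both $u$ and $v$ for $u\ne v$ and $0$ on the diagonal; its eigenvalues are $\lambda_1(H)\ge\lambda_2(H)\ge\cdots$. For a connected $(d,r)$-regular $H$, $\lambda_1(H)=d(r-1)$ is the trivial eigenvalue. A connected $(d,r)$-regular hypergraph is right-sided Ramanujan if every non-trivial eigenvalue $\lambda$ (i.e. $\lambda_2(H),\lambda_3(H),\dots$) satisfies $\lambda\le r-2+2\sqrt{(d-1)(r-1)}$. *)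

(* Defs.v *)
From HB Require Import structures.
From mathcomp Require Import all_boot all_order all_algebra.
From mathcomp Require Import reals.

Set Implicit Arguments.
Unset Strict Implicit.
Unset Printing Implicit Defensive.

Import Order.TTheory GRing.Theory Num.Theory.
Local Open Scope ring_scope.

(* The edges form a set, so there are no repeated edges. *)
Record hypergraph : Type := Hypergraph {
  vertex : finType;
  edges : {set {set vertex}}
}.

Definition isomorphic (H K : hypergraph) : Prop :=
  exists f : vertex H -> vertex K,
    bijective f /\ edges K = [set f @: (e : {set vertex H}) | e in edges H].

Definition infinitely_many (P : hypergraph -> Prop) : Prop :=
  exists F : nat -> hypergraph,
    (forall n, P (F n)) /\ (forall m n, m <> n -> ~ isomorphic (F m) (F n)).

Definition regular (d r : nat) (H : hypergraph) : Prop :=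
  (forall e, e \in edges H -> #|e| = r) /\
  (forall v : vertex H, #|[set e in edges H | v \in e]| = d).

Definition codegree (H : hypergraph) (u v : vertex H) : nat :=
  #|[set e in edges H | (u \in e) && (v \in e)]|.

Definition connected (H : hypergraph) : Prop :=
  (0 < #|vertex H|)%N /\
  (forall u v : vertex H,
     connect [rel x y | [exists e in edges H, (x \in e) && (y \in e)]] u v).

Definition adjacency (R : nzRingType) (H : hypergraph) : 'M[R]_#|vertex H| :=
  \matrix_(i, j)
    if i == j then 0 else (codegree (enum_val i) (enum_val j))%:R.

(* s lists the eigenvalues of A with multiplicity, in nonincreasing order;
   such an s is unique, and exists over the reals for symmetric A. *)
Definition ordered_spectrum (R : realType) (n : nat) (A : 'M[R]_n) (s : seq R)
  : Prop :=
  sorted >=%R s /\ char_poly A = \prod_(x <- s) ('X - x%:P).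

(* The eigenvalues lambda_2, lambda_3, ... are s`_1, s`_2, ... *)
Definition right_sided_ramanujan (R : realType) (d r : nat) (H : hypergraph)
  : Prop :=
  [/\ connected H, regular d r H &
      exists s : seq R,
        ordered_spectrum (adjacency R H) s /\
        (forall i, (0 < i < size s)%N ->
           s`_i <= r%:R - 2 + 2 * Num.sqrt ((d%:R - 1) * (r%:R - 1)))].

Definition prime_power (q : nat) : Prop :=
  exists p k : nat, [/\ prime p, (0 < k)%N & q = (p ^ k)%N].

(* Main.v *)
Require Import Defs.
From HB Require Import structures.
From mathcomp Require Import all_boot all_order all_algebra finfield ssrAC.
From mathcomp Require Import boolp reals complex ring lra.

(** A connected incidence structure is lifted to a double cover by a sign for each flag
    (vertex, edge).  The adjacency spectrum of the lift is the old one together with that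
    of S S^T - d, where S is the signed incidence matrix, so it suffices (Marcus, Spielman
    and Srivastava) to find a signing for which the largest eigenvalue of the bipartite
    matrix [[0, S], [S^T, 0]] is below sqrt (d - 1) + sqrt (r - 1).

    With one variable x_v per vertex, averaging det (diag x - A) over the sign of an edge
    uv applies 1 - D_u D_v to it, and a biased sign applies 1 - c D_u D_v with c >= 0 to
    another such determinant.  These operators preserve the multi-affine functions that do
    not vanish when all Im x_v > 0.  Hence all partial averages, and all convex combinations
    of the two children of a partial average, are real-rooted, and if the parent is
    positive on [rho, oo) then so is one child.  The average over all signs is the matching
    polynomial, whose vertex recursion gives positivity beyond sqrt (d - 1) + sqrt (r - 1).

    The towers of lifts start from the complete design of d-subsets of d + 1 points and
    from the affine plane over a field with d elements. *)

Set Implicit Arguments.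
Unset Strict Implicit.
Unset Printing Implicit Defensive.

Import Order.TTheory GRing.Theory Num.Theory.
Local Open Scope ring_scope.

(** * Multi-affine functions *)

Section MultiAffine.
Variables (K : comNzRingType) (T : finType).
Implicit Types (x : {ffun T -> K}) (F G : {ffun T -> K} -> K).

Definition upd x v t : {ffun T -> K} := [ffun w => if w == v then t else x w].

(* For F affine in the v-th variable, this is the partial derivative. *)
Definition pdiff v F x := F (upd x v 1) - F (upd x v 0).

Definition multi_affine F :=
  forall x v t, F (upd x v t) = F (upd x v 0) + t * pdiff v F x.

(** The effect of averaging over the sign of an edge [uv]: [c = 1] belongs to a fair sign,
    [c = 1 - m ^+ 2] to a sign of mean [m]. *)
Definition edge_op (c : K) u v F x := F x - c * pdiff u (pdiff v F) x.

Lemma updE x v t w : upd x v t w = if w == v then t else x w.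
Proof. by rewrite ffunE. Qed.

Lemma upd_id x v : upd x v (x v) = x.
Proof. by apply/ffunP=> w; rewrite ffunE; case: eqP => [->|]. Qed.

Lemma upd_upd x v s t : upd (upd x v s) v t = upd x v t.
Proof. by apply/ffunP=> w; rewrite !ffunE; case: eqP. Qed.

Lemma upd_comm x u v s t :
  u != v -> upd (upd x u s) v t = upd (upd x v t) u s.
Proof.
move=> uv; apply/ffunP=> w; rewrite !ffunE.
by case: (eqVneq w v) => [->|//]; rewrite eq_sym (negPf uv).
Qed.

Lemma eq_pdiff v F G : F =1 G -> pdiff v F =1 pdiff v G.
Proof. by move=> e x; rewrite /pdiff !e. Qed.

Lemma pdiff_upd v F x t : pdiff v F (upd x v t) = pdiff v F x.
Proof. by rewrite /pdiff !upd_upd. Qed.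

Lemma multi_affine_pdiff v F : multi_affine F -> multi_affine (pdiff v F).
Proof.
move=> aF x w t; have [<-|vw] := eqVneq v w.
  by rewrite {3}/pdiff !pdiff_upd subrr mulr0 addr0.
rewrite /pdiff !(upd_comm x _ _ (_ : w != v)) 1?eq_sym //.
rewrite (aF _ w t) (aF (upd x v 0) w t) /pdiff.
by ring.
Qed.

Lemma multi_affine_edge_op c u v F :
  multi_affine F -> multi_affine (edge_op c u v F).
Proof.
move=> aF x w t; have a2 := multi_affine_pdiff u (multi_affine_pdiff v aF).
rewrite /edge_op aF a2 /pdiff; ring.
Qed.

Definition edge_ops (es : seq (T * T)) F :=
  foldl (fun G e => edge_op 1 e.1 e.2 G) F es.

Lemma eq_edge_op c u v F G : F =1 G -> edge_op c u v F =1 edge_op c u v G.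
Proof. by move=> e x; rewrite /edge_op /pdiff !e. Qed.

Lemma eq_edge_ops es F G : F =1 G -> edge_ops es F =1 edge_ops es G.
Proof.
rewrite /edge_ops; elim: es F G => [//|e es IH] F G FG /=.
exact/IH/eq_edge_op.
Qed.

Lemma edge_ops_lin es a b F G :
  edge_ops es (fun x => a * F x + b * G x) =1
  (fun x => a * edge_ops es F x + b * edge_ops es G x).
Proof.
rewrite /edge_ops; elim: es F G => [//|e es IH] F G x /=.
rewrite -IH; apply: eq_edge_ops => y; rewrite /edge_op /pdiff; ring.
Qed.

(** For loopless [es], this is the sum over the matchings of [es] inside [W] of (-1)^k, k being the
    number of edges, times the product of [x] over the uncovered vertices of [W]. The recursion
    decides whether [e] belongs to the matching. *)
Fixpoint matching_poly x (es : seq (T * T)) (W : {set T}) : K :=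
  if es is e :: es' then
    matching_poly x es' W -
    (if (e.1 \in W) && (e.2 \in W) then
       matching_poly x es' (W :\ e.1 :\ e.2) else 0)
  else \prod_(v in W) x v.

Lemma pdiff_monomial v (W : {set T}) x :
  pdiff v (fun y => \prod_(w in W) y w) x =
  if v \in W then \prod_(w in W :\ v) x w else 0.
Proof.
rewrite /pdiff; case: ifPn => vW.
  have E t : \prod_(w in W) upd x v t w = t * \prod_(w in W :\ v) x w.
    rewrite (big_setD1 v vW) /= updE eqxx; congr (_ * _).
    by apply: eq_bigr => w; rewrite updE !inE => /andP[/negPf ->].
  by rewrite !E mul1r mul0r subr0.
have E t : \prod_(w in W) upd x v t w = \prod_(w in W) x w.
  apply: eq_bigr => w wW; rewrite updE; case: eqP => // e.
  by rewrite -e wW in vW.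
by rewrite !E subrr.
Qed.

(** When the product of the factors 1 - D_u D_v is expanded, a choice of edges survives only if it
    is a matching, since D_v kills a monomial without x_v. *)
Lemma edge_ops_monomial es (W : {set T}) x :
  (forall e, e \in es -> e.1 != e.2) ->
  edge_ops es (fun y => \prod_(w in W) y w) x = matching_poly x es W.
Proof.
elim: es W => [//|e es IH] W ne /=.
have ne' e' : e' \in es -> e'.1 != e'.2 by move=> h; apply: ne; rewrite inE h orbT.
have {}ne : e.1 != e.2 by apply: ne; rewrite inE eqxx.
pose W' := W :\ e.1 :\ e.2; pose b : K := ((e.1 \in W) && (e.2 \in W))%:R.
have E : edge_op 1 e.1 e.2 (fun y => \prod_(w in W) y w) =1
   (fun y => 1 * \prod_(w in W) y w + (- b) * \prod_(w in W') y w).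
  move=> y; rewrite /edge_op mul1r mul1r mulNr; congr (_ - _).
  rewrite (eq_pdiff _ (pdiff_monomial e.2 W)) /b; case: (boolP (e.2 \in W)) => e2.
    rewrite pdiff_monomial !inE ne /= andbT; case: ifP; rewrite ?mul0r ?mul1r //.
    by rewrite /W' !setDDl setUC.
  by rewrite andbF mul0r /pdiff subrr.
rewrite (eq_edge_ops _ E) edge_ops_lin !IH // mul1r /b.
by case: ifP; rewrite ?mulN1r ?oppr0 ?mul0r ?subr0.
Qed.

End MultiAffine.

(** * Stability *)

Section Stable.
Variable (R : rcfType).
Local Notation C := R[i].
Local Notation imc := (@complex.Im R).

Lemma imcD (x y : C) : imc (x + y) = imc x + imc y.
Proof. by case: x y => [a b] [c d]. Qed.

Lemma imcN (x : C) : imc (- x) = - imc x.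
Proof. by case: x. Qed.

Lemma imcV (x : C) : imc x^-1 = - imc x / (complex.Re x ^+ 2 + imc x ^+ 2).
Proof. by case: x => a b /=; rewrite mulNr. Qed.

Lemma imc_inv_lt0 (x : C) : 0 < imc x -> imc x^-1 < 0.
Proof.
move=> x0; rewrite imcV mulNr oppr_lt0 divr_gt0 //.
by rewrite ltr_wpDl ?sqr_ge0 // exprn_gt0.
Qed.

Lemma imcZ (c : R) (x : C) : imc (c%:C%C * x) = c * imc x.
Proof. by case: x => a b /=; rewrite mul0r addr0. Qed.

Lemma imci : imc 'i%C = 1.
Proof. by []. Qed.

Section TwoVariables.
Variables (a b c e : C).
Hypothesis st : forall s t : C, 0 < imc s -> 0 < imc t ->
  a + b * s + c * t + e * s * t != 0.

Lemma stable2_pdiff s : e != 0 -> 0 < imc s -> c + e * s != 0.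
Proof.
move=> e0 s0; apply/eqP=> cs.
have ab0 : a + b * s != 0.
  by have := st s0 (_ : 0 < imc 'i%C); rewrite imci ltr01 => /(_ isT);
     rewrite -addrA -mulrDl cs mul0r addr0.
(* s is a pole of the solution t of the equation; perturb s so that t goes to i oo *)
pose w : C := 'i%C * (a + b * s) / e.
(* [eta] keeps [s'] in the upper half-plane; the other bound on [eps] keeps [t] there. *)
pose eta : R := imc s / 2 / (1 + `|imc w|).
have eta0 : 0 < eta by rewrite !divr_gt0 // ltr_pwDl.
have big0 : 0 < 1 + `|imc (b / e)| by rewrite ltr_pwDl.
pose eps : R := Num.min eta (1 + `|imc (b / e)|)^-1.
have eps0 : 0 < eps by rewrite lt_min eta0 invr_gt0.
pose s' := s + eps%:C%C * w.
(* By the choice of [w], this is the root in [t] of the equation at [s']. *)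
pose t := - (b / e) + (eps^-1)%:C%C * 'i%C.
have s'0 : 0 < imc s'.
  rewrite imcD imcZ.
  have h : eps * `|imc w| < imc s.
    apply: (@le_lt_trans _ _ (eta * `|imc w|)).
      by rewrite ler_wpM2r // ge_min lexx.
    rewrite /eta; apply: (@le_lt_trans _ _ (imc s / 2)); last by lra.
    rewrite -mulrA ler_piMr ?divr_ge0 ?(ltW s0) //.
    by rewrite mulrC ler_pdivrMr ?mul1r ?ltr_pwDl // lerDr.
  have : - (eps * imc w) <= eps * `|imc w|.
    by rewrite -mulrN ler_pM2l // -normrN ler_norm.
  by lra.
have t0 : 0 < imc t.
  rewrite imcD imcN imcZ imci mulr1 addrC subr_gt0.
  apply: (@lt_le_trans _ _ (1 + `|imc (b / e)|)).
    by rewrite (le_lt_trans (ler_norm _)) // ltrDr.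
  by rewrite -[leLHS]invrK lef_pV2 ?posrE ?invr_gt0 // ge_min lexx orbT.
have := st s'0 t0; rewrite /s' /t => /eqP; apply.
have epsC : eps%:C%C != 0 :> C.
  by rewrite eq_complex /= eqxx andbT (gt_eqF eps0).
have -> : (eps^-1)%:C%C = (eps%:C%C)^-1 :> C by rewrite fmorphV.
have i2 : 'i%C * 'i%C = -1 :> C by rewrite -expr2 sqr_i.
have -> : a + b * (s + eps%:C%C * w) + c * (- (b / e) + eps%:C%C^-1 * 'i%C) +
  e * (s + eps%:C%C * w) * (- (b / e) + eps%:C%C^-1 * 'i%C) =
  a + b * s + (c + e * s) * (- (b / e) + eps%:C%C^-1 * 'i%C) + ('i%C * 'i%C) * (a + b * s).
  by rewrite /w; field; rewrite epsC e0.
by rewrite cs i2; ring.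
Qed.

Lemma stable2_edge_op (k : R) s t : 0 <= k -> 0 < imc s -> 0 < imc t ->
  a + b * s + c * t + e * s * t - k%:C%C * e != 0.
Proof.
move=> k0 s0 t0.
have [e0|e0] := eqVneq e 0; first by rewrite {2}e0 mulr0 subr0; exact: st.
apply/eqP=> h.
have ces := stable2_pdiff e0 s0.
(* moving t to t' restores a zero of the original polynomial *)
pose t' := t - k%:C%C * (s + c / e)^-1.
have se0 : s + c / e != 0.
  apply: contraNneq ces => h0; have <- : e * (s + c / e) = c + e * s by field.
  by rewrite h0 mulr0.
(* Otherwise [- (c / e)] would be a zero of c + e s in the upper half-plane, against
   [stable2_pdiff]. *)
have ce : 0 <= imc (c / e).
  rewrite leNgt; apply/negP => lt0.
  have := @stable2_pdiff (- (c / e)) e0; rewrite imcN oppr_gt0 => /(_ lt0) /eqP; apply.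
  by field.
have t'0 : 0 < imc t'.
  rewrite imcD imcN imcZ.
  have : imc (s + c / e)^-1 < 0 by apply: imc_inv_lt0; rewrite imcD; lra.
  move=> /ltW lt0; have := mulr_ge0_le0 k0 lt0; lra.
have /eqP := st s0 t'0; apply.
have E : a + b * s + c * t' + e * s * t' =
   a + b * s + c * t + e * s * t - k%:C%C * e.
  rewrite /t'; field; rewrite e0 /=.
  by apply: contraNneq ces => h0; rewrite addrC mulrC h0.
by rewrite E.
Qed.

End TwoVariables.

Section Multi.
Variable T : finType.
Implicit Types F : {ffun T -> C} -> C.

Definition stable F :=
  multi_affine F /\ forall x : {ffun T -> C}, (forall v, 0 < imc (x v)) -> F x != 0.

(** Freezing all variables but those at [u] and [v] leaves a bilinear polynomial in two variables,
    whose coefficient of [s * t] is the mixed derivative. *)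
Lemma stable_edge_op (k : R) u v F : u != v -> 0 <= k ->
  stable F -> stable (edge_op k%:C%C u v F).
Proof.
move=> uv k0 [aF sF]; split; first exact: multi_affine_edge_op.
move=> x xH; rewrite /edge_op.
pose f s t := F (upd (upd x u s) v t).
have E s t : f s t = f 0 0 + (f 1 0 - f 0 0) * s + (f 0 1 - f 0 0) * t
    + pdiff u (pdiff v F) x * s * t.
  have aDF := multi_affine_pdiff v aF.
  rewrite /f aF aDF upd_comm // aF; set P := pdiff u _ x.
  by rewrite /pdiff -!(upd_comm x _ _ uv); ring.
have Fx : F x = f (x u) (x v) by rewrite /f upd_id upd_id.
rewrite Fx E; apply: stable2_edge_op => // s t s0 t0.
rewrite -E; apply: sF => w; rewrite !updE.
by case: eqP => // _; case: eqP.
Qed.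

Lemma stable_edge_ops es F : (forall e, e \in es -> e.1 != e.2) ->
  stable F -> stable (edge_ops es F).
Proof.
rewrite /edge_ops; elim: es F => [//|e es IH] F ne sF /=; apply: IH.
  by move=> e' h; apply: ne; rewrite inE h orbT.
have -> : (1 : C) = (1 : R)%:C%C by [].
by apply: stable_edge_op => //; apply: ne; rewrite inE eqxx.
Qed.

End Multi.
End Stable.

(** * Signed averages of characteristic polynomials *)

Section CharDet.
Variables (K : comNzRingType) (n : nat).
Implicit Types (x : {ffun 'I_n -> K}) (A M : 'M[K]_n).

(** The characteristic polynomial with one variable per row, which makes it multi-affine; a constant
    [x] gives back the usual one. *)
Definition char_det A x := \det (\matrix_(i, j) ((i == j)%:R * x i - A i j)).

Definition set_row M u (r : 'rV[K]_n) : 'M[K]_n :=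
  \matrix_(i, j) if i == u then r 0 j else M i j.

Lemma det_set_row_lin M u a b (r r' : 'rV[K]_n) :
  \det (set_row M u (a *: r + b *: r')) =
  a * \det (set_row M u r) + b * \det (set_row M u r').
Proof.
apply: (determinant_multilinear (i0 := u)).
- by apply/rowP=> j; rewrite !mxE eqxx.
- by apply/matrixP=> i j; rewrite !mxE eq_sym (negPf (neq_lift _ _)).
- by apply/matrixP=> i j; rewrite !mxE eq_sym (negPf (neq_lift _ _)).
Qed.

Lemma set_row_id M u : set_row M u (row u M) = M.
Proof. by apply/matrixP=> i j; rewrite !mxE; case: eqP => [->|]. Qed.

Lemma set_rowC M u v r r' : u != v ->
  set_row (set_row M u r) v r' = set_row (set_row M v r') u r.
Proof.
move=> uv; apply/matrixP=> i j; rewrite !mxE.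
by case: eqP => // ->; rewrite eq_sym (negPf uv).
Qed.

Lemma char_det_upd A x u t :
  char_det A (upd x u t) =
  char_det A (upd x u 0) +
  t * \det (set_row (\matrix_(i, j) ((i == j)%:R * x i - A i j)) u (delta_mx 0 u)).
Proof.
rewrite /char_det; set M := \matrix_(i, j) _.
set M0 := \matrix_(i, j) _; set M1 := \matrix_(i, j) _.
have E s : \matrix_(i, j) ((i == j)%:R * upd x u s i - A i j) =
   set_row M1 u (1 *: (- row u A) + s *: delta_mx 0 u).
  apply/matrixP=> i j; rewrite !mxE updE; case: (eqVneq i u) => [->|//] /=.
  by rewrite mul1r mulrC addrC eq_sym.
by rewrite /M /M0 !E !det_set_row_lin; ring.
Qed.

Lemma pdiff_char_det A x u :
  pdiff u (char_det A) x =
  \det (set_row (\matrix_(i, j) ((i == j)%:R * x i - A i j)) u (delta_mx 0 u)).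
Proof. by rewrite /pdiff (char_det_upd A x u 1) mul1r addrC addKr. Qed.

Lemma multi_affine_char_det A : multi_affine (char_det A).
Proof. by move=> x v t; rewrite char_det_upd pdiff_char_det. Qed.

Lemma pdiff2_char_det A x u v : u != v ->
  pdiff u (pdiff v (char_det A)) x =
  \det (set_row (set_row (\matrix_(i, j) ((i == j)%:R * x i - A i j))
     u (delta_mx 0 u)) v (delta_mx 0 v)).
Proof.
move=> uv; rewrite (eq_pdiff _ (fun y => pdiff_char_det A y v)) /pdiff.
set M := \matrix_(i, j) ((i == j)%:R * x i - A i j).
have E s : set_row (\matrix_(i, j) ((i == j)%:R * upd x u s i - A i j)) v (delta_mx 0 v) =
   set_row (set_row M v (delta_mx 0 v)) u (1 *: (- row u A) + s *: delta_mx 0 u).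
  rewrite -set_rowC //; apply/matrixP=> i j; rewrite !mxE updE.
  case: ifP => // _; case: (eqVneq i u) => [->|//] /=.
  by rewrite mul1r mulrC addrC eq_sym.
by rewrite !E !det_set_row_lin (set_rowC _ _ _ uv); ring.
Qed.

Definition edge_mx (e : 'I_n * 'I_n) : 'M[K]_n := delta_mx e.1 e.2 + delta_mx e.2 e.1.

(* The linear coefficient L is the same for all t, so that it cancels in averages
   over a symmetric distribution of t. *)
Lemma char_det_edge A e x : e.1 != e.2 ->
  exists L, forall t,
    char_det (A + t *: edge_mx e) x =
    char_det A x - t * L - t ^+ 2 * pdiff e.1 (pdiff e.2 (char_det A)) x.
Proof.
case: e => u v /= uv; rewrite pdiff2_char_det // /char_det.
set M := \matrix_(i, j) ((i == j)%:R * x i - A i j).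
pose D r r' := \det (set_row (set_row M u r) v r').
have Dlin_r r a b r1 r2 : D r (a *: r1 + b *: r2) = a * D r r1 + b * D r r2.
  exact: det_set_row_lin.
have Dlin_l r a b r1 r2 : D (a *: r1 + b *: r2) r = a * D r1 r + b * D r2 r.
  by rewrite /D !(set_rowC _ _ _ uv) det_set_row_lin.
have Dalt r : D r r = 0.
  by apply: (determinant_alternate uv) => j; rewrite !mxE !eqxx (negPf uv).
(* The [t ^+ 2] term carries the two unit rows in exchanged order; this swap is the source of its
   minus sign. *)
have Dswap : D (delta_mx 0 v) (delta_mx 0 u) = - D (delta_mx 0 u) (delta_mx 0 v).
  have := Dalt (1 *: delta_mx 0 u + 1 *: delta_mx 0 v).
  rewrite Dlin_l !Dlin_r !Dalt !mul1r add0r addr0 => h.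
  by apply/eqP; rewrite -addr_eq0 addrC; apply/eqP.
exists (D (delta_mx 0 v) (row v M) + D (row u M) (delta_mx 0 u)) => t.
have E : \matrix_(i, j) ((i == j)%:R * x i - (A + t *: edge_mx (u, v)) i j) =
   set_row (set_row M u (1 *: row u M + (- t) *: delta_mx 0 v)) v
      (1 *: row v M + (- t) *: delta_mx 0 u).
  apply/matrixP=> i j; rewrite /edge_mx !mxE /=.
  case: (eqVneq i v) => [->|iv].
    by rewrite (eq_sym v u) (negPf uv) /= ?eqxx /=; ring.
  by case: (eqVneq i u) => [->|iu] /=; ring.
have DM : D (row u M) (row v M) = \det M.
  by rewrite /D set_row_id set_row_id.
rewrite E -/(D _ _) Dlin_l !Dlin_r Dswap DM -/(D (delta_mx 0 u) (delta_mx 0 v)).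
ring.
Qed.

Lemma char_det0 x : char_det 0 x = \prod_(v in [set: 'I_n]) x v.
Proof.
rewrite /char_det -[\matrix_(i, j) _](_ : diag_mx (\row_i x i) = _).
  by rewrite det_diag; apply: eq_big => i; rewrite ?inE // mxE.
apply/matrixP=> i j; rewrite !mxE; case: eqP => [->|_].
  by rewrite mulr1n mul1r subr0.
by rewrite mulr0n mul0r subr0.
Qed.

End CharDet.

Section StableCharDet.
Variables (R : rcfType) (n : nat).
Local Notation C := R[i].
Local Notation toC := (real_complex R).

(** If [w] is a left null vector of diag x - A, then w A w^* is the sum of x_j |w_j|^2. It is real
    because [A] is real symmetric, so the sum of Im x_j |w_j|^2 vanishes and [w = 0]. *)
Lemma stable_char_det (A : 'M[R]_n) : A^T = A -> stable (char_det (map_mx toC A)).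
Proof.
move=> sA; split; first exact: multi_affine_char_det.
move=> x xH; apply/det0P => -[w w0 wM].
pose p i := complex.Re (w 0 i); pose q i := complex.Im (w 0 i).
pose al i := complex.Re (x i); pose be i := complex.Im (x i).
have eqj j : \sum_i w 0 i * (A i j)%:C%C = w 0 j * x j.
  move/rowP/(_ j): wM; rewrite !mxE => h; apply/esym/subr0_eq; rewrite -[RHS]h.
  under [RHS]eq_bigr do rewrite !mxE mulrBr.
  rewrite sumrB; congr (_ - _); rewrite (bigD1 j) //= eqxx mul1r big1 ?addr0 //.
  by move=> i /negPf ->; rewrite mul0r mulr0.
have eqI j : \sum_i q i * A i j = p j * be j + q j * al j.
  have -> : \sum_i q i * A i j = complex.Im (\sum_i w 0 i * (A i j)%:C%C).
    rewrite (big_morph (@complex.Im R) (id1 := 0) (op1 := +%R)) //; last by case=> ? ? [].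
    by apply: eq_bigr => i _; rewrite /q; case: (w 0 i) => a b /=; ring.
  by rewrite eqj /p /q /al /be; case: (w 0 j) => a b; case: (x j) => c d /=; ring.
have eqR j : \sum_i p i * A i j = p j * al j - q j * be j.
  have -> : \sum_i p i * A i j = complex.Re (\sum_i w 0 i * (A i j)%:C%C).
    rewrite (big_morph (@complex.Re R) (id1 := 0) (op1 := +%R)) //; last by case=> ? ? [].
    by apply: eq_bigr => i _; rewrite /p; case: (w 0 i) => a b /=; ring.
  by rewrite eqj /p /q /al /be; case: (w 0 j) => a b; case: (x j) => c d /=; ring.
have S0 : \sum_j be j * (p j ^+ 2 + q j ^+ 2) = 0.
  have -> : \sum_j be j * (p j ^+ 2 + q j ^+ 2) =
     \sum_j (\sum_i q i * A i j) * p j - \sum_j (\sum_i p i * A i j) * q j.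
    by rewrite -sumrB; apply: eq_bigr => j _; rewrite eqI eqR; ring.
  apply/eqP; rewrite subr_eq0; apply/eqP.
  under eq_bigr do rewrite mulr_suml.
  rewrite exchange_big /=; apply: eq_bigr => i _; rewrite mulr_suml.
  apply: eq_bigr => j _; rewrite -{1}sA mxE; ring.
have sq_ge0 j : 0 <= be j * (p j ^+ 2 + q j ^+ 2).
  by rewrite mulr_ge0 ?addr_ge0 ?sqr_ge0 // ltW // xH.
case/eqP: w0; apply/rowP=> j; rewrite mxE.
move/eqP: S0; rewrite psumr_eq0 // => /allP/(_ j (mem_index_enum _)).
rewrite /= mulf_eq0 (gt_eqF (xH j)) /= paddr_eq0 ?sqr_ge0 // !sqrf_eq0.
by rewrite /p /q; case: (w 0 j) => a b /= /andP[/eqP-> /eqP->].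
Qed.

End StableCharDet.

Section SignedAverage.
Variables (R : realType) (n : nat).
Local Notation C := R[i].
Local Notation toC := (real_complex R).
Implicit Types (A : 'M[R]_n) (es : seq ('I_n * 'I_n)).

Fixpoint avg_char_poly A es : {poly R} :=
  if es is e :: es' then
    2^-1 *: (avg_char_poly (A + 1 *: edge_mx R e) es' +
             avg_char_poly (A + (-1) *: edge_mx R e) es')
  else char_poly A.

Definition cst (K : Type) (z : K) : {ffun 'I_n -> K} := [ffun=> z].

Lemma char_poly_char_det A (K : comNzRingType) (f : {rmorphism R -> K}) (z : K) :
  (map_poly f (char_poly A)).[z] = char_det (map_mx f A) (cst z).
Proof.
rewrite /char_poly /char_det -det_map_mx -horner_evalE -det_map_mx.
congr (\det _); apply/matrixP => i j; rewrite !mxE /= ffunE horner_evalE.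
rewrite rmorphB rmorphMn /= map_polyX map_polyC /= !hornerE.
by rewrite -mulr_natl hornerM -polyC_natr hornerC hornerX.
Qed.

(** A sign of mean [m] has second moment 1. The linear term is therefore that of
    [B + m *: edge_mx K e], and the variance [1 - m ^+ 2] is what remains in front of the mixed
    derivative. *)
Lemma avg_char_det (K : comUnitRingType) (B : 'M[K]_n) e m x :
  (2%:R : K) \is a GRing.unit -> e.1 != e.2 ->
  (1 + m) / 2%:R * char_det (B + 1 *: edge_mx K e) x +
  (1 - m) / 2%:R * char_det (B + (-1) *: edge_mx K e) x =
  edge_op (1 - m ^+ 2) e.1 e.2 (char_det (B + m *: edge_mx K e)) x.
Proof.
move=> u2 ne; have [L E] := char_det_edge B x ne.
have PE : pdiff e.1 (pdiff e.2 (char_det (B + m *: edge_mx K e))) x =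
   pdiff e.1 (pdiff e.2 (char_det B)) x.
  rewrite !pdiff2_char_det //; congr (\det _); apply/matrixP=> i j.
  rewrite /edge_mx !mxE; do 2!case: ifP => //.
  by move=> e1 e2; rewrite e1 e2 /= addr0 mulr0 addr0.
rewrite /edge_op PE !E; set P := pdiff _ _ _; set D := char_det B x.
have h : 2%:R / 2%:R = 1 :> K by rewrite divrr.
transitivity (2%:R / 2%:R * (D - m * L - P)); first by rewrite expr1n sqrrN expr1n; ring.
by rewrite h; ring.
Qed.

Lemma map_edge_mx (K : comNzRingType) (f : {rmorphism R -> K}) A t e :
  map_mx f (A + t *: edge_mx R e) = map_mx f A + f t *: edge_mx K e.
Proof.
by apply/matrixP=> i j; rewrite /edge_mx !mxE rmorphD rmorphM rmorphD /= !rmorph_nat.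
Qed.

(** One fair average per edge, which commutes with the later operators by linearity. The target ring
    is general because the complex numbers serve for stability and the identity map for the matching
    polynomial. *)
Lemma avg_char_polyE (K : comUnitRingType) (f : {rmorphism R -> K}) A es z :
  (forall e, e \in es -> e.1 != e.2) ->
  (map_poly f (avg_char_poly A es)).[z] =
  edge_ops es (char_det (map_mx f A)) (cst z).
Proof.
elim: es A => [|e es IH] A ne /=; first exact: char_poly_char_det.
have ne' e' : e' \in es -> e'.1 != e'.2 by move=> h; apply: ne; rewrite inE h orbT.
have {}ne : e.1 != e.2 by apply: ne; rewrite inE eqxx.
have u2 : (2%:R : K) \is a GRing.unit.
  by rewrite -(rmorph_nat f) rmorph_unit // unitfE pnatr_eq0.
rewrite map_polyZ rmorphD hornerZ hornerD !IH // mulrDr -edge_ops_lin.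
apply: eq_edge_ops => x; rewrite !map_edge_mx fmorphV rmorph_nat rmorphN rmorph1.
have := avg_char_det (map_mx f A) 0 x u2 ne.
by rewrite addr0 subr0 div1r scale0r addr0 expr0n subr0.
Qed.

Lemma monic_size_avg A es :
  avg_char_poly A es \is monic /\ size (avg_char_poly A es) = n.+1.
Proof.
elim: es A => [|e es IH] A /=; first by rewrite char_poly_monic size_char_poly.
set p := avg_char_poly _ _; set q := avg_char_poly _ _.
have [mp sp] : p \is monic /\ size p = n.+1 by apply: IH.
have [mq sq] : q \is monic /\ size q = n.+1 by apply: IH.
have c : (p + q)`_n = 2.
  move: mp mq; rewrite !monicE !lead_coefE sp sq /= => /eqP h /eqP h'.
  by rewrite coefD h h'.
have s : size (p + q) = n.+1.
  apply/eqP; rewrite eqn_leq (leq_trans (size_polyD _ _)) ?sp ?sq ?maxnn //=.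
  by rewrite ltnNge; apply/negP=> /leq_sizeP/(_ n (leqnn n)) /eqP; rewrite c pnatr_eq0.
have s2 : size (2^-1 *: (p + q)) = n.+1 by rewrite size_scale ?invr_eq0 ?pnatr_eq0.
by rewrite s2 monicE lead_coefE s2 /= coefZ c mulVf ?pnatr_eq0 //; split.
Qed.

End SignedAverage.

(** * Real-rooted polynomials *)

Definition real_rooted (R : nzRingType) (p : {poly R}) :=
  exists s : seq R, p = \prod_(r <- s) ('X - r%:P).

Definition positive_from (R : numDomainType) (rho : R) (p : {poly R}) :=
  forall y, rho <= y -> 0 < p.[y].

Section RealRooted.
Variable R : realType.
Local Notation toC := (real_complex R).
Implicit Types p q : {poly R}.

(** The zeros of a real polynomial are closed under conjugation, so none in the upper half-plane
    means none in the lower one. *)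
Lemma real_rooted_stable p : p \is monic ->
  (forall z : R[i], 0 < complex.Im z -> (map_poly toC p).[z] != 0) ->
  real_rooted p.
Proof.
move=> mp nz; pose P := map_poly toC p.
have [s Ps] := closed_field_poly_normal P.
have PE : P = \prod_(z <- s) ('X - z%:P).
  by rewrite Ps lead_coef_map /= (monicP mp) rmorph1 scale1r.
have conjP z : P.[z^*%C] = (P.[z])^*%C.
  rewrite -horner_map /= /P -map_poly_comp; congr (_.[_]); apply: eq_map_poly => x /=.
  by rewrite oppr0.
have rs z : z \in s -> z = (complex.Re z)%:C%C.
  move=> zs; have rz : P.[z] = 0 by apply/rootP; rewrite PE root_prod_XsubC.
  have h1 : complex.Im z <= 0 by rewrite leNgt; apply/negP=> /nz/eqP; apply.
  have h2 : complex.Im z^*%C <= 0.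
    by rewrite leNgt; apply/negP=> /nz/eqP; apply; rewrite conjP rz conjc0.
  case: z h1 h2 {zs rz} => a b /= h1; rewrite oppr_le0 => h2.
  by have -> : b = 0 by apply/eqP; rewrite eq_le h1 h2.
exists (map (@complex.Re R) s); apply: (map_poly_inj toC).
rewrite -/P PE big_map rmorph_prod /= big_seq [RHS]big_seq.
by apply: eq_bigr => z zs; rewrite rmorphB /= map_polyX map_polyC /= -rs.
Qed.

(** All roots lie below [rho], so every linear factor is positive and increasing from there on. *)
Lemma real_rooted_monotone p rho : real_rooted p -> positive_from rho p ->
  forall y, rho <= y -> p.[rho] <= p.[y].
Proof.
move=> [s ->] pos y rhoy; rewrite !horner_prod !big_seq.
have lts r : r \in s -> r < rho.
  move=> rs; rewrite ltNge; apply/negP=> /pos.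
  by rewrite (rootP _) ?ltxx // root_prod_XsubC.
apply: ler_prod => r /lts rr; rewrite !hornerXsubC; lra.
Qed.

Lemma real_rooted_positive_large p :
  real_rooted p -> exists M, positive_from M p.
Proof.
move=> [s ->]; exists (1 + \sum_(r <- s) `|r|) => y My.
rewrite horner_prod big_seq; apply: prodr_gt0 => r rs; rewrite hornerXsubC subr_gt0.
apply: lt_le_trans My; rewrite -[ltLHS]add0r ltr_leD ?ltr01 //.
rewrite (le_trans (ler_norm r)) // (big_rem r rs) /= lerDl.
by apply: sumr_ge0.
Qed.

(* While (1 - t) p + t q is positive on [rho, oo) it is increasing there, hence at
   least delta := min p(rho) q(rho); this margin allows a step of t of fixed size. *)
Lemma positive_from_continuation p q rho :
  (forall t, 0 <= t <= 1 -> real_rooted ((1 - t) *: p + t *: q)) ->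
  positive_from rho p -> 0 < q.[rho] -> positive_from rho q.
Proof.
move=> rr pp q0.
have rrp : real_rooted p.
  by have := rr 0; rewrite subr0 scale1r scale0r addr0; apply; rewrite lexx ler01.
have rrq : real_rooted q.
  by have := rr 1; rewrite subrr scale1r scale0r add0r; apply; rewrite lexx ler01.
have [Mp posp] := real_rooted_positive_large rrp.
have [Mq posq] := real_rooted_positive_large rrq.
(* Beyond [M] both [p] and [q] are positive, so only [rho, M] needs care; there [K] bounds |q -
   p|. *)
pose M := Num.max Mp Mq.
have [ub hub] := poly_itv_bound (q - p) rho M.
pose K := Num.max ub 0 + 1.
have K0 : 0 < K by rewrite ltr_wpDl // le_max lexx orbT.
have ubK y : rho <= y <= M -> `|q.[y] - p.[y]| <= K.
  move=> /hub; rewrite hornerD hornerN => /le_trans; apply.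
  by rewrite (le_trans (_ : _ <= Num.max ub 0)) ?le_max ?lexx // lerDl.
pose f t := (1 - t) *: p + t *: q.
have fE t y : (f t).[y] = (1 - t) * p.[y] + t * q.[y] by rewrite !hornerE.
pose delta := Num.min p.[rho] q.[rho].
have d0 : 0 < delta by rewrite lt_min pp.
have frho t : 0 <= t <= 1 -> delta <= (f t).[rho].
  move=> /andP[t0 t1]; rewrite fE.
  have dp : delta <= p.[rho] by rewrite ge_min lexx.
  have dq : delta <= q.[rho] by rewrite ge_min lexx orbT.
  by nra.
have margin t : 0 <= t <= 1 -> positive_from rho (f t) ->
    forall y, rho <= y -> delta <= (f t).[y].
  move=> t01 pos y ry; apply: le_trans (frho t t01) _.
  exact: (real_rooted_monotone (rr t t01) pos).
have step t t' : 0 <= t <= 1 -> 0 <= t' <= 1 -> `|t' - t| * K < delta ->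
    positive_from rho (f t) -> positive_from rho (f t').
  move=> t01 /andP[t'0 t'1] small pos y ry.
  have [yM|My] := leP y M.
    have := margin t t01 pos y ry.
    have : `|(t' - t) * (q.[y] - p.[y])| < delta.
      rewrite normrM; apply: le_lt_trans small; rewrite ler_wpM2l //.
      by apply: ubK; rewrite ry yM.
    rewrite ltr_norml => /andP[h1 _]; rewrite !fE => h2; lra.
  have py : 0 < p.[y] by apply: posp; rewrite (le_trans _ (ltW My)) // le_max lexx.
  have qy : 0 < q.[y] by apply: posq; rewrite (le_trans _ (ltW My)) // le_max lexx orbT.
  rewrite fE; have [->|t'n1] := eqVneq t' 1; first by rewrite subrr mul0r mul1r add0r.
  by rewrite ltr_wpDr ?mulr_ge0 ?(ltW qy) // mulr_gt0 // subr_gt0 lt_neqAle t'n1.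
pose N := (Num.bound (K / delta)).+1.
have N0 : 0 < N%:R :> R by rewrite ltr0n.
have KN : N%:R^-1 * K < delta.
  rewrite mulrC ltr_pdivrMr // -ltr_pdivrMl // mulrC.
  apply: lt_trans (archi_boundP _) _; first by rewrite divr_ge0 // ltW.
  by rewrite ltr_nat.
have all_k k : (k <= N)%N -> positive_from rho (f (k%:R / N%:R)).
  elim: k => [|k IH] kN.
    by rewrite mul0r /f subr0 scale1r scale0r addr0.
  apply: (step (k%:R / N%:R)); last by apply: IH; exact: ltnW.
  - by rewrite divr_ge0 //= ler_pdivrMr // mul1r ler_nat ltnW.
  - by rewrite divr_ge0 //= ler_pdivrMr // mul1r ler_nat.
  - by rewrite -mulrBl -natrB // subSnn mul1r gtr0_norm ?invr_gt0.
have := all_k N (leqnn N).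
by rewrite divff ?gt_eqF // /f subrr scale0r scale1r add0r.
Qed.

End RealRooted.

(** * Choosing the signs one edge at a time *)

Section SigningExists.
Variables (R : realType) (n : nat).
Local Notation toC := (real_complex R).
Implicit Types (A : 'M[R]_n) (es : seq ('I_n * 'I_n)).

Lemma edge_mx_sym e : (edge_mx R e : 'M_n)^T = edge_mx R e.
Proof. by rewrite /edge_mx linearD /= !trmx_delta addrC. Qed.

Lemma sym_edge_mx A t e : A^T = A -> (A + t *: edge_mx R e)^T = A + t *: edge_mx R e.
Proof. by move=> sA; rewrite linearD linearZ /= edge_mx_sym sA. Qed.

(** As [m] runs over [-1, 1] these are all convex combinations of the two children. Each is obtained
    by [edge_op] with [1 - m ^+ 2 >= 0] from a stable determinant, so it has no zero in the upper
    half-plane. *)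
Lemma real_rooted_biased_avg A e es m :
  A^T = A -> (forall e', e' \in e :: es -> e'.1 != e'.2) -> -1 <= m <= 1 ->
  real_rooted (((1 + m) / 2) *: avg_char_poly (A + 1 *: edge_mx R e) es +
               ((1 - m) / 2) *: avg_char_poly (A + (-1) *: edge_mx R e) es).
Proof.
move=> sA ne /andP[m0 m1].
have ne' e' : e' \in es -> e'.1 != e'.2 by move=> h; apply: ne; rewrite inE h orbT.
have {}ne : e.1 != e.2 by apply: ne; rewrite inE eqxx.
apply: real_rooted_stable.
  set p := avg_char_poly _ _; set q := avg_char_poly _ _.
  have [mp sp] : p \is monic /\ size p = n.+1 by apply: monic_size_avg.
  have [mq sq] : q \is monic /\ size q = n.+1 by apply: monic_size_avg.
  set r := _ + _.
  have c : r`_n = 1.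
    move: mp mq; rewrite !monicE !lead_coefE sp sq /= => /eqP h /eqP h'.
    by rewrite coefD !coefZ h h'; lra.
  have s : size r = n.+1.
    apply/eqP; rewrite eqn_leq (leq_trans (size_polyD _ _)) /=; last first.
      by rewrite geq_max -{1}sp -{1}sq !size_scale_leq.
    by rewrite ltnNge; apply/negP=> /leq_sizeP/(_ n (leqnn n)) /eqP; rewrite c oner_eq0.
  by rewrite monicE lead_coefE s /= c.
move=> z z0; rewrite rmorphD /= !map_polyZ hornerD !hornerZ !avg_char_polyE //.
rewrite -edge_ops_lin.
have u2 : (2%:R : R[i]) \is a GRing.unit by rewrite unitfE pnatr_eq0.
have E x := avg_char_det (map_mx toC A) m%:C%C x u2 ne.
have E' : (fun x => toC ((1 + m) / 2) * char_det (map_mx toC (A + 1 *: edge_mx R e)) x +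
      toC ((1 - m) / 2) * char_det (map_mx toC (A + (-1) *: edge_mx R e)) x) =1
   edge_op (1 - m ^+ 2)%:C%C e.1 e.2 (char_det (map_mx toC (A + m *: edge_mx R e))).
  move=> x; rewrite !map_edge_mx rmorphB rmorphXn rmorph1 -E.
  by rewrite !rmorphM !fmorphV rmorphD rmorphB rmorphN rmorph1 rmorph_nat.
rewrite (eq_edge_ops _ E').
have [_ st] : stable (edge_ops es (edge_op (1 - m ^+ 2)%:C%C e.1 e.2
    (char_det (map_mx toC (A + m *: edge_mx R e))))).
  apply: stable_edge_ops => //; apply: stable_edge_op => //; first by nra.
  exact/stable_char_det/sym_edge_mx.
by apply: st => v; rewrite ffunE.
Qed.

(** At [rho] one of the children is positive, since their mean is. The segment from the mean to that
    child consists of averages with bias [t] or [- t], all real-rooted, so continuation gives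
    positivity on the whole half-line. *)
Lemma signing_step A e es rho :
  A^T = A -> (forall e', e' \in e :: es -> e'.1 != e'.2) ->
  positive_from rho (avg_char_poly A (e :: es)) ->
  exists2 t : R, t = 1 \/ t = -1 & positive_from rho (avg_char_poly (A + t *: edge_mx R e) es).
Proof.
move=> sA ne /= pos.
have rr := real_rooted_biased_avg sA ne.
set p := avg_char_poly (A + 1 *: _) es in pos rr *.
set q := avg_char_poly (A + (-1) *: _) es in pos rr *.
have [p0|p0] := ltP 0 p.[rho].
  exists 1; first by left.
  apply: positive_from_continuation pos p0 => t /andP[t0 t1].
  have -> : (1 - t) *: (2^-1 *: (p + q)) + t *: p =
     ((1 + t) / 2) *: p + ((1 - t) / 2) *: q.
    rewrite scalerA scalerDr addrAC -scalerDl; congr (_ *: _ + _); lra.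
  by apply: rr; lra.
exists (-1); first by right.
have q0 : 0 < q.[rho] by have := pos rho (lexx _); rewrite hornerZ hornerD; lra.
apply: positive_from_continuation pos q0 => t /andP[t0 t1].
have -> : (1 - t) *: (2^-1 *: (p + q)) + t *: q =
   ((1 + (- t)) / 2) *: p + ((1 - (- t)) / 2) *: q.
  rewrite scalerA scalerDr -addrA -scalerDl; congr (_ *: _ + _ *: _); lra.
by apply: rr; lra.
Qed.

Lemma signing_exists A es rho :
  A^T = A -> uniq es -> (forall e, e \in es -> e.1 != e.2) ->
  positive_from rho (avg_char_poly A es) ->
  exists s : 'I_n * 'I_n -> R, (forall e, s e = 1 \/ s e = -1) /\
    positive_from rho (char_poly (A + \sum_(e <- es) s e *: edge_mx R e)).
Proof.
elim: es A => [|e es IH] A sA ues ne pos.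
  by exists (fun=> 1); split=> [_|]; [left | rewrite big_nil addr0].
have [t ht pos'] := signing_step sA ne pos.
case/andP: ues => nes ues.
have ne' e' : e' \in es -> e'.1 != e'.2 by move=> h; apply: ne; rewrite inE h orbT.
have [s [hs poss]] := IH _ (sym_edge_mx _ _ sA) ues ne' pos'.
exists (fun e' => if e' == e then t else s e'); split=> [e'|]; first by case: eqP.
rewrite big_cons eqxx addrA; move: poss; congr (positive_from _ (char_poly (_ + _))).
rewrite big_seq [RHS]big_seq; apply: eq_bigr => e' e'es.
by case: eqP => // h; rewrite h (negPf nes) in e'es.
Qed.

End SigningExists.

(** * The matching polynomial beyond its largest root *)

Section MatchingRecursion.
Variables (K : comNzRingType) (T : finType).
Implicit Types (es : seq (T * T)) (W : {set T}) (v : T) (x : {ffun T -> K}).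

Definition neighbours es v : seq T :=
  flatten [seq if e.1 == v then [:: e.2] else
               if e.2 == v then [:: e.1] else [::] | e <- es].

Lemma neighbours_cons e es v :
  neighbours (e :: es) v =
  (if e.1 == v then [:: e.2] else if e.2 == v then [:: e.1] else [::])
  ++ neighbours es v.
Proof. by []. Qed.

Lemma mem_neighbours es v w :
  w \in neighbours es v -> ((v, w) \in es) || ((w, v) \in es).
Proof.
case/flattenP => l /mapP[[a b] abes ->] /=; case: eqP => [<-|_].
  by rewrite inE => /eqP->; rewrite abes.
by case: eqP => [<-|//]; rewrite inE => /eqP->; rewrite abes orbT.
Qed.

Lemma neighbours_mem es v w :
  ((v, w) \in es) || ((w, v) \in es) -> w \in neighbours es v.
Proof.
case/orP => h; apply/flattenP; eexists; try by apply: map_f; exact: h.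
  by rewrite /= eqxx inE.
by rewrite /=; case: eqP => [->|_]; rewrite ?eqxx inE.
Qed.

Lemma setD1C W u v : W :\ u :\ v = W :\ v :\ u.
Proof. by rewrite !setDDl setUC. Qed.

(** A matching inside [W] either misses [v], which contributes the factor [x v], or joins [v] to
    exactly one neighbour [w]. *)
Lemma matching_poly_vertex x es W v :
  (forall e, e \in es -> e.1 != e.2) -> v \in W ->
  matching_poly x es W =
  x v * matching_poly x es (W :\ v) -
  \sum_(w <- neighbours es v | w \in W) matching_poly x es (W :\ v :\ w).
Proof.
elim: es W => [|[a b] es IH] W ne vW.
  by rewrite big_nil subr0 /= (big_setD1 v).
have ne' e' : e' \in es -> e'.1 != e'.2 by move=> h; apply: ne; rewrite inE h orbT.
have {ne} ab : a != b by apply: (ne (a, b)); rewrite inE eqxx.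
rewrite neighbours_cons [LHS]/= IH //.
have [av|av] := eqVneq a v.
  have E w : matching_poly x ((a, b) :: es) (W :\ v :\ w) = matching_poly x es (W :\ v :\ w).
    by rewrite /= av !inE eqxx andbF /= subr0.
  under [in RHS]eq_bigr do rewrite E.
  rewrite /= big_cons av vW !inE eqxx /= subr0.
  by case: ifP => _; ring.
have [bv|bv] := eqVneq b v.
  have E w : matching_poly x ((a, b) :: es) (W :\ v :\ w) = matching_poly x es (W :\ v :\ w).
    by rewrite /= bv !inE eqxx !andbF subr0.
  under [in RHS]eq_bigr do rewrite E.
  rewrite /= big_cons bv vW !inE eqxx /= andbF andbT subr0 setD1C.
  by case: ifP => _; ring.
rewrite /= !inE av bv /=; case: ifPn => abW; last first.
  rewrite !subr0; congr (_ - _); apply: eq_bigr => w _.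
  rewrite !inE av bv /= ifN ?subr0 //.
  by apply: contra abW => /andP[/andP[_ ->] /andP[_ ->]].
rewrite (IH (W :\ a :\ b)) ?inE ?(eq_sym v) ?av ?bv //=.
have -> : W :\ a :\ b :\ v = W :\ v :\ a :\ b by rewrite setD1C (setD1C W a).
have -> : \sum_(w <- neighbours es v | w \in W :\ a :\ b)
     matching_poly x es (W :\ v :\ a :\ b :\ w) =
   \sum_(w <- neighbours es v | w \in W)
     (if (a \in W :\ v :\ w) && (b \in W :\ v :\ w) then
        matching_poly x es (W :\ v :\ w :\ a :\ b) else 0).
  rewrite big_mkcond [RHS]big_mkcond; apply: eq_bigr => w _.
  rewrite !inE av bv /=; case/andP: abW => -> ->; rewrite !andbT !(eq_sym w).
  case: (boolP (w \in W)) => wW; rewrite ?andbF //= andbT andbC.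
  by case: ifP => // _; congr matching_poly; rewrite setD1C (setD1C _ a).
by rewrite sumrB; ring.
Qed.

End MatchingRecursion.

Section MatchingPositive.
Variables (R : realFieldType) (T : finType) (es : seq (T * T)) (x : {ffun T -> R}).
(** [c v] is the ratio bound at [v], [k v] the one at the neighbours of [v], and [D v] bounds the
    degree. [below] closes the induction at a vertex that has lost a neighbour, [above] gives
    positivity at a vertex of full degree. *)
Variables (c k D : T -> R).
Hypothesis ne : forall e, e \in es -> e.1 != e.2.
Hypothesis ck : forall e, e \in es -> c e.1 = k e.2 /\ c e.2 = k e.1.
Hypothesis k_gt0 : forall v, 0 < k v.
Hypothesis degD : forall v, (size (neighbours es v))%:R <= D v.
Hypothesis below : forall v, (D v - 1) / k v + c v <= x v.
Hypothesis above : forall v, D v / k v < x v.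

(* Heilmann-Lieb: c v bounds the ratio of the values on W and on W :\ v from below
   as soon as v has lost a neighbour. *)
Lemma matching_poly_ratio (W : {set T}) :
  0 < matching_poly x es W /\
  (forall v, v \in W -> (count [in W] (neighbours es v) < size (neighbours es v))%N ->
     c v * matching_poly x es (W :\ v) <= matching_poly x es W).
Proof.
have [N] := ubnP #|W|; elim: N W => [//|N IH] W; rewrite ltnS => cW.
(* In [W :\ v] each neighbour [w] has lost [v], so by induction the ratio there is at least
   [c w = k v]; this bounds every term of the vertex recursion. *)
have key v : v \in W ->
   0 < matching_poly x es (W :\ v) /\
   (x v - (count [in W] (neighbours es v))%:R / k v) * matching_poly x es (W :\ v)
     <= matching_poly x es W.
  move=> vW.
  have cWv : (#|W :\ v| < N)%N by move: cW; rewrite (cardsD1 v W) vW.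
  have [pos ratio] := IH _ cWv.
  split=> //; rewrite (matching_poly_vertex x ne vW) mulrBl lerD2l lerN2.
  rewrite -sum1_count natr_sum !mulr_suml big_seq_cond [leRHS]big_seq_cond.
  apply: ler_sum => w /andP[wn wW]; rewrite mul1r ler_pdivlMl //.
  have wv := mem_neighbours wn.
  have vw : v \in neighbours es w by apply: neighbours_mem; rewrite orbC.
  have cw : c w = k v by case/orP: wv => /ck[].
  have wnv : w != v by case/orP: wv => /ne; rewrite //= eq_sym.
  rewrite -cw; apply: ratio; first by rewrite !inE wnv.
  rewrite ltn_neqAle count_size andbT -all_count; apply/negP => /allP/(_ v vw).
  by rewrite !inE eqxx.
split.
  have [->|[v vW]] := set_0Vmem W.
    have E l : matching_poly x l set0 = 1.
      by elim: l => [|e l IHl] /=; rewrite ?big_set0 // IHl inE subr0.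
    by rewrite E.
  have [pos le] := key v vW; apply: lt_le_trans le; rewrite mulr_gt0 // subr_gt0.
  apply: le_lt_trans (above v); rewrite ler_pM2r ?invr_gt0 //.
  by apply: le_trans (degD v); rewrite ler_nat count_size.
move=> v vW lt; have [pos le] := key v vW; apply: le_trans le.
rewrite ler_pM2r // lerBrDr addrC; apply: le_trans (below v); rewrite lerD2r.
rewrite ler_pM2r ?invr_gt0 // lerBrDr; apply: le_trans (degD v).
by rewrite natr1 ler_nat.
Qed.

Lemma matching_poly_gt0 (W : {set T}) : 0 < matching_poly x es W.
Proof. by have [] := matching_poly_ratio W. Qed.

End MatchingPositive.

(** * Signings of biregular bipartite graphs *)

Section BipartiteSigning.
Variables (R : realType) (n m : nat) (inc : 'I_n -> 'I_m -> bool).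

Definition sign_mx (s : 'I_n -> 'I_m -> bool) : 'M[R]_(n, m) :=
  \matrix_(i, j) if inc i j then (-1) ^+ s i j else 0.

Let pairs : seq ('I_n * 'I_m) := enum [pred p | inc p.1 p.2].
Let edge (p : 'I_n * 'I_m) : 'I_(n + m) * 'I_(n + m) := (lshift m p.1, rshift n p.2).
Let es := [seq edge p | p <- pairs].

Lemma size_neighbours (T : finType) (l : seq (T * T)) v :
  size (neighbours l v) = count (fun e => (e.1 == v) || (e.2 == v)) l.
Proof.
elim: l => [//|e l IH]; rewrite neighbours_cons size_cat IH /=; congr (_ + _)%N.
by case: eqP => //=; case: eqP.
Qed.

Lemma edge_neq e : e \in es -> e.1 != e.2.
Proof. by case/mapP=> p _ -> /=; rewrite -val_eqE /= ltn_eqF // ltn_addr. Qed.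

Lemma edge_inj : injective edge.
Proof. by case=> [i j] [i' j'] [/val_inj /= -> /addnI/val_inj ->]. Qed.

Lemma count_pairs (P : pred ('I_n * 'I_m)) :
  count P pairs = #|[set p | inc p.1 p.2 && P p]|.
Proof.
rewrite -size_filter cardE; apply/perm_size/uniq_perm.
- exact/filter_uniq/enum_uniq.
- exact: enum_uniq.
by move=> p; rewrite mem_filter !mem_enum !inE andbC.
Qed.

Lemma size_neighbours_lshift i :
  size (neighbours es (lshift m i)) = #|[set j | inc i j]|.
Proof.
rewrite size_neighbours count_map.
rewrite (@eq_count _ _ (fun p => p.1 == i)); last first.
  by move=> p /=; rewrite eq_lshift eq_rlshift orbF.
have pair_inj : injective (fun j : 'I_m => (i, j)) by move=> ? ? [].
rewrite count_pairs -(card_imset _ pair_inj).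
apply: eq_card => -[i' j]; apply/idP/imsetP; rewrite !inE /=.
  by case/andP=> h /eqP e; exists j; rewrite ?inE -e.
by case=> j' ; rewrite inE => h [-> ->]; rewrite h eqxx.
Qed.

Lemma size_neighbours_rshift j :
  size (neighbours es (rshift n j)) = #|[set i | inc i j]|.
Proof.
rewrite size_neighbours count_map.
rewrite (@eq_count _ _ (fun p => p.2 == j)); last first.
  by move=> p /=; rewrite eq_rshift eq_lrshift.
have pair_inj : injective (fun i : 'I_n => (i, j)) by move=> ? ? [].
rewrite count_pairs -(card_imset _ pair_inj).
apply: eq_card => -[i j']; apply/idP/imsetP; rewrite !inE /=.
  by case/andP=> h /eqP e; exists i; rewrite ?inE -e.
by case=> i' ; rewrite inE => h [-> ->]; rewrite h eqxx.
Qed.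

Lemma edge_mx_block p :
  edge_mx R (edge p) = block_mx 0 (delta_mx p.1 p.2) (delta_mx p.1 p.2)^T 0.
Proof.
apply/matrixP=> u v; rewrite -(splitK u) -(splitK v).
case: (split u) => i; case: (split v) => j /=;
  rewrite ?block_mxEul ?block_mxEur ?block_mxEdl ?block_mxEdr /edge_mx !mxE /=;
  rewrite ?eq_lshift ?eq_rshift ?eq_lrshift ?eq_rlshift ?andbF ?andFb ?addr0 ?add0r //=.
by rewrite andbC.
Qed.

Lemma sum_edge_mx (s : 'I_(n + m) * 'I_(n + m) -> R) (l : seq ('I_n * 'I_m)) :
  let S := \sum_(p <- l) s (edge p) *: delta_mx p.1 p.2 in
  \sum_(e <- map edge l) s e *: edge_mx R e = block_mx 0 S S^T 0.
Proof.
elim: l => [|p l IH] /=; first by rewrite !big_nil trmx0 block_mx0.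
rewrite !big_cons IH edge_mx_block scale_block_mx add_block_mx !scaler0 !addr0.
by rewrite linearD linearZ.
Qed.

Lemma matching_signing_exists (d r : nat) :
  (forall i, #|[set j | inc i j]| = d) -> (forall j, #|[set i | inc i j]| = r) ->
  (1 < d)%N -> (1 < r)%N -> (1 < d.-1 * r.-1)%N ->
  let rho := Num.sqrt (d%:R - 1) + Num.sqrt (r%:R - 1) in
  exists s, positive_from rho (char_poly (block_mx 0 (sign_mx s) (sign_mx s)^T 0)).
Proof.
move=> rdeg cdeg d1 r1 dr /=.
set a := Num.sqrt (d%:R - 1); set b := Num.sqrt (r%:R - 1).
have dE : d%:R - 1 = d.-1%:R :> R by rewrite -(prednK (ltnW d1)) -natr1 addrK.
have rE : r%:R - 1 = r.-1%:R :> R by rewrite -(prednK (ltnW r1)) -natr1 addrK.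
have a0 : 0 < a by rewrite sqrtr_gt0 subr_gt0 ltr1n.
have b0 : 0 < b by rewrite sqrtr_gt0 subr_gt0 ltr1n.
have a2 : a ^+ 2 = d%:R - 1 by rewrite sqr_sqrtr // dE ler0n.
have b2 : b ^+ 2 = r%:R - 1 by rewrite sqr_sqrtr // rE ler0n.
have ab1 : 1 < a * b.
  rewrite -(ltr_pXn2r (_ : 0 < 2)%N) ?nnegrE ?mulr_ge0 ?ltW // expr1n exprMn a2 b2.
  by rewrite dE rE -natrM ltr1n.
have [s [hs pos]] : exists s : 'I_(n + m) * 'I_(n + m) -> R,
    (forall e, s e = 1 \/ s e = -1) /\
    positive_from (a + b) (char_poly (0 + \sum_(e <- es) s e *: edge_mx R e)).
  apply: signing_exists.
  - by rewrite trmx0.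
  - by rewrite (map_inj_uniq edge_inj) enum_uniq.
  - exact: edge_neq.
  move=> y yab.
  have := @avg_char_polyE _ _ R idfun 0 es y edge_neq.
  rewrite map_poly_id // => ->.
  have E z : char_det (map_mx idfun (0 : 'M[R]_(n + m))) z = \prod_(v in setT) z v.
    by rewrite map_mx0 char_det0.
  rewrite (eq_edge_ops _ E) edge_ops_monomial; last exact: edge_neq.
  pose sp (p q : R) (v : 'I_(n + m)) := if split v is inl _ then p else q.
  have spl p q i : sp p q (lshift m i) = p.
    by rewrite /sp -[lshift m i]/(unsplit (inl i)) unsplitK.
  have spr p q j : sp p q (rshift n j) = q.
    by rewrite /sp -[rshift n j]/(unsplit (inr j)) unsplitK.
  (* The ratio bound is [b] at vertices of degree [d] and [a] at those of degree [r]. Since (d - 1)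
     / a = a and (r - 1) / b = b, [below] is an equality at [a + b], and there [above] amounts to
     [1 < a * b]. *)
  apply: (@matching_poly_gt0 _ _ _ _ (sp b a) (sp a b) (sp d%:R r%:R)).
  - exact: edge_neq.
  - by move=> e /mapP[p _ ->] /=; rewrite !spl !spr.
  - by move=> v; rewrite -(splitK v); case: (split v) => i; rewrite /= ?spl ?spr.
  - by move=> v; rewrite -(splitK v); case: (split v) => i;
      rewrite /= ?spl ?spr ?size_neighbours_lshift ?size_neighbours_rshift ?rdeg ?cdeg.
  - move=> v; rewrite -(splitK v); case: (split v) => i;
      rewrite /= ?spl ?spr ffunE -?a2 -?b2 expr2 mulfK ?gt_eqF //.
    by rewrite addrC.
  - move=> v; rewrite -(splitK v); case: (split v) => i;
      rewrite /= ?spl ?spr ffunE ltr_pdivrMr //.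
      have -> : d%:R = a ^+ 2 + 1 by rewrite a2 subrK.
      by nra.
    have -> : r%:R = b ^+ 2 + 1 by rewrite b2 subrK.
    by nra.
exists (fun i j => s (edge (i, j)) == -1).
set S := sign_mx _; move: pos; rewrite add0r sum_edge_mx.
suff -> : \sum_(p <- pairs) s (edge p) *: delta_mx p.1 p.2 = S by [].
apply/matrixP=> i j; rewrite summxE mxE big_enum /=.
have -> : (if inc i j then (-1) ^+ (s (edge (i, j)) == -1) else 0) =
          if inc i j then s (edge (i, j)) else 0 :> R.
  case: ifP => // _; case: (hs (edge (i, j))) => ->.
    by rewrite gt_eqF // (lt_trans (ltrN10 _) ltr01).
  by rewrite eqxx expr1.
case: ifPn => ij.
  rewrite (bigD1 (i, j)) //= big1 ?addr0 ?mxE ?eqxx ?mulr1 //.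
  move=> [i' j'] /= /andP[_ ne]; rewrite !mxE.
  rewrite (_ : _ && _ = false) ?mulr0 //; apply: contraNF ne => /andP[/eqP-> /eqP->].
  by rewrite eqxx.
rewrite big1 // => -[i' j'] /= ij'; rewrite !mxE.
rewrite (_ : _ && _ = false) ?mulr0 //.
by apply: contraNF ij => /andP[/eqP-> /eqP->].
Qed.

End BipartiteSigning.

(** * Spectrum of signed Gram matrices *)

Definition ramanujan_bound (R : realType) (d r : nat) : R :=
  r%:R - 2 + 2 * Num.sqrt ((d%:R - 1) * (r%:R - 1)).

(** Subtracting [d] clears the diagonal when every row has [d] entries equal to 1 or -1. For the
    unsigned incidence matrix the result is the adjacency matrix. *)
Definition gram (R : realType) (d n m : nat) (B : 'M[R]_(n, m)) : 'M[R]_n :=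
  B *m B^T - d%:R%:M.

Section Gram.
Variable R : realType.

Lemma symmetric_real_rooted n (A : 'M[R]_n) : A^T = A -> real_rooted (char_poly A).
Proof.
move=> sA; apply: real_rooted_stable; first exact: char_poly_monic.
move=> z z0; rewrite char_poly_char_det.
by have [_ st] := stable_char_det sA; apply: st => v; rewrite ffunE.
Qed.

Lemma gram_sym d n m (B : 'M[R]_(n, m)) : (gram d B)^T = gram d B.
Proof. by rewrite /gram linearB /= trmx_mul trmxK tr_scalar_mx. Qed.

Lemma sqr_ramanujan_bound d r : (1 < d)%N -> (1 < r)%N ->
  (Num.sqrt (d%:R - 1) + Num.sqrt (r%:R - 1)) ^+ 2 = ramanujan_bound R d r + d%:R.
Proof.
move=> d1 r1; have h k : (1 < k)%N -> 0 <= k%:R - 1 :> R.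
  by move=> k1; rewrite subr_ge0 ler1n ltnW.
rewrite /ramanujan_bound sqrtrM ?h // sqrrD !sqr_sqrtr ?h //.
by rewrite -mulr_natl; ring.
Qed.

(* An eigenvalue x of S S^T - d gives the eigenvalue sqrt (x + d) of the bipartite
   matrix. *)
Lemma gram_eigenvalue_le d r n m (S : 'M[R]_(n, m)) (w : 'rV[R]_n) x :
  (1 < d)%N -> (1 < r)%N ->
  positive_from (Num.sqrt (d%:R - 1) + Num.sqrt (r%:R - 1))
     (char_poly (block_mx 0 S S^T 0)) ->
  w *m gram d S = x *: w -> w != 0 -> x <= ramanujan_bound R d r.
Proof.
move=> d1 r1 pos wS w0; rewrite leNgt; apply/negP => xb.
set rho := _ + _ in pos.
have rho0 : 0 <= rho by rewrite addr_ge0 ?sqrtr_ge0.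
have xd : rho ^+ 2 < x + d%:R by rewrite sqr_ramanujan_bound // ltrD2r.
pose sg := Num.sqrt (x + d%:R).
have sg2 : sg ^+ 2 = x + d%:R.
  by rewrite sqr_sqrtr // (le_trans _ (ltW xd)) // sqr_ge0.
have rs : rho < sg.
  by rewrite -(ltr_pXn2r (_ : 0 < 2)%N) ?nnegrE ?sqrtr_ge0 // sg2.
have := pos sg (ltW rs); rewrite (rootP _) ?ltxx // -eigenvalue_root_char.
apply/eigenvalueP; exists (row_mx (sg *: w) (w *m S)).
  rewrite mul_row_block !mulmx0 addr0 add0r scale_row_mx scalerA -expr2 sg2 -scalemxAl.
  congr row_mx; have := wS; rewrite /gram mulmxBr mul_mx_scalar => /eqP.
  by rewrite subr_eq -scalerDl mulmxA => /eqP.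
rewrite -[0]row_mx0; apply: contra w0 => /eqP/eq_row_mx[/eqP + _].
by rewrite scaler_eq0 gt_eqF // (le_lt_trans rho0).
Qed.

(** Conjugation by a unipotent block matrix makes the matrix block triangular, with no division by
    2. *)
Lemma det_block_sym (K : comNzRingType) n (P Q : 'M[K]_n) :
  \det (block_mx P Q Q P) = \det (P + Q) * \det (P - Q).
Proof.
have E : block_mx 1%:M 0 (- 1%:M) 1%:M *m block_mx P Q Q P *m block_mx 1%:M 0 1%:M 1%:M =
   block_mx (P + Q) Q 0 (P - Q).
  rewrite !mulmx_block !mul1mx !mulmx1 !mul0mx !mulmx0 !addr0 !add0r !mulNmx !mul1mx.
  by congr block_mx; [rewrite addrA addrK addNr | rewrite addrC].
have := congr1 determinant E; rewrite !det_mulmx !det_lblock !det1 !mulr1 !mul1r => ->.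
by rewrite det_ublock.
Qed.

Lemma char_poly_block_sym n (P Q : 'M[R]_n) :
  char_poly (block_mx P Q Q P) = char_poly (P + Q) * char_poly (P - Q).
Proof.
rewrite /char_poly /char_poly_mx map_block_mx scalar_mx_block opp_block_mx add_block_mx.
rewrite !add0r det_block_sym !map_mxD !map_mxN; congr (_ * _); congr determinant.
  by rewrite opprD addrA.
by rewrite opprD addrA.
Qed.

End Gram.

(** * Two-lifts of incidence structures *)

Definition mk_sheet n (b : bool) (i : 'I_n) : 'I_(n + n) :=
  if b then rshift n i else lshift n i.

Definition base n (u : 'I_(n + n)) : 'I_n := match split u with inl i | inr i => i end.

Definition sheet n (u : 'I_(n + n)) : bool := if split u is inr _ then true else false.

Lemma base_mk n b (i : 'I_n) : base (mk_sheet b i) = i.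
Proof.
rewrite /base /mk_sheet; case: b.
  by rewrite -[rshift n i]/(unsplit (inr i)) unsplitK.
by rewrite -[lshift n i]/(unsplit (inl i)) unsplitK.
Qed.

Lemma sheet_mk n b (i : 'I_n) : sheet (mk_sheet b i) = b.
Proof.
rewrite /sheet /mk_sheet; case: b.
  by rewrite -[rshift n i]/(unsplit (inr i)) unsplitK.
by rewrite -[lshift n i]/(unsplit (inl i)) unsplitK.
Qed.

Lemma mk_sheetK n (u : 'I_(n + n)) : mk_sheet (sheet u) (base u) = u.
Proof.
rewrite /mk_sheet /sheet /base -[RHS](splitK u); by case: (split u).
Qed.

Definition collinear n m (inc : 'I_n -> 'I_m -> bool) : rel 'I_n :=
  [rel x y | [exists j, inc x j && inc y j]].

(** The invariant of the tower. Allowing one eigenvalue above the bound, with multiplicity, accounts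
    for the trivial one without naming it; [col_inj] lets the columns form a set of edges. *)
Record ramanujan_incidence (R : realType) (d r n m : nat) (inc : 'I_n -> 'I_m -> bool)
    : Prop := RamanujanIncidence {
  row_degree : forall i, #|[set j | inc i j]| = d;
  col_degree : forall j, #|[set i | inc i j]| = r;
  col_inj : forall j j', (forall i, inc i j = inc i j') -> j = j';
  inc_nonempty : (0 < n)%N;
  inc_connected : forall u v, connect (collinear inc) u v;
  inc_spectrum : exists s : seq R,
    char_poly (gram d (sign_mx R inc (fun _ _ => false))) = \prod_(x <- s) ('X - x%:P) /\
    (count (fun x => (ramanujan_bound R d r < x)%R) s <= 1)%N
}.

(** A flag with sign [false] lifts to two flags within the sheets, one with sign [true] to two flags
    across them. *)
Definition lift_inc n m (inc s : 'I_n -> 'I_m -> bool) (u : 'I_(n + n)) (w : 'I_(m + m)) :=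
  inc (base u) (base w) && (sheet u (+) sheet w == s (base u) (base w)).

Section Lift.
Variables (R : realType) (d r n m : nat) (inc s : 'I_n -> 'I_m -> bool).
Local Notation inc' := (lift_inc inc s).

Lemma lift_inc_mk b b' i j :
  inc' (mk_sheet b i) (mk_sheet b' j) = inc i j && (b (+) b' == s i j).
Proof. by rewrite /lift_inc !base_mk !sheet_mk. Qed.

Lemma lift_row_degree u : #|[set w | inc' u w]| = #|[set j | inc (base u) j]|.
Proof.
pose h j := mk_sheet (sheet u (+) s (base u) j) j.
have h_inj : injective h by move=> ? ? /(congr1 (@base m)); rewrite !base_mk.
rewrite -(card_imset _ h_inj).
apply: eq_card => w; rewrite inE; apply/idP/imsetP.
  rewrite /lift_inc => /andP[iw /eqP sw]; exists (base w); first by rewrite inE.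
  by rewrite /h -sw addKb mk_sheetK.
by case=> j; rewrite inE => ij ->; rewrite /lift_inc base_mk sheet_mk ij addKb eqxx.
Qed.

Lemma lift_col_degree w : #|[set u | inc' u w]| = #|[set i | inc i (base w)]|.
Proof.
pose h i := mk_sheet (s i (base w) (+) sheet w) i.
have h_inj : injective h by move=> ? ? /(congr1 (@base n)); rewrite !base_mk.
rewrite -(card_imset _ h_inj).
apply: eq_card => u; rewrite inE; apply/idP/imsetP.
  rewrite /lift_inc => /andP[iw /eqP sw]; exists (base u); first by rewrite inE.
  by rewrite /h -sw addbK mk_sheetK.
by case=> i; rewrite inE => ij ->; rewrite /lift_inc base_mk sheet_mk ij addbK eqxx.
Qed.

(** The union over both sheets recovers the base column, and then any single incident vertex
    determines the sheet, which is why columns must be nonempty. *)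
Lemma lift_col_inj : (forall j, exists i, inc i j) ->
  (forall j j', (forall i, inc i j = inc i j') -> j = j') ->
  forall w w', (forall u, inc' u w = inc' u w') -> w = w'.
Proof.
move=> ne inj w w' E.
have bE i v : inc i (base v) = inc' (mk_sheet true i) v || inc' (mk_sheet false i) v.
  rewrite -[in RHS](mk_sheetK v) !lift_inc_mk; case: inc => //=.
  by case: (sheet v); case: s.
have bw : base w = base w' by apply: inj => i; rewrite !bE !E.
have [i iw] := ne (base w).
have := E (mk_sheet (s i (base w) (+) sheet w) i).
rewrite /lift_inc base_mk sheet_mk -bw iw addbK eqxx /=.
move/esym/eqP => h; rewrite -(mk_sheetK w) -(mk_sheetK w') -bw; congr mk_sheet.
by move: h; case: (s _ _); case: (sheet w); case: (sheet w').
Qed.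

Local Notation B := (sign_mx R inc (fun _ _ => false)).
Local Notation S := (sign_mx R inc s).

(** Split the incidence matrix by sign into [Bp] and [Bm]. The lift is the block matrix with [Bp] on
    and [Bm] off the diagonal, so sums and differences of the sheets see [B = Bp + Bm] and
    [S = Bp - Bm]. *)
Lemma char_poly_gram_lift :
  char_poly (gram d (sign_mx R inc' (fun _ _ => false))) =
  char_poly (gram d B) * char_poly (gram d S).
Proof.
pose Bp : 'M[R]_(n, m) := \matrix_(i, j) (inc i j && ~~ s i j)%:R.
pose Bm : 'M[R]_(n, m) := \matrix_(i, j) (inc i j && s i j)%:R.
have -> : sign_mx R inc' (fun _ _ => false) = block_mx Bp Bm Bm Bp.
  apply/matrixP=> u w; rewrite -(mk_sheetK u) -(mk_sheetK w) mxE lift_inc_mk expr0.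
  move: (base u) (base w) => i j; rewrite /mk_sheet.
  by case: (sheet u); case: (sheet w);
    rewrite ?block_mxEul ?block_mxEur ?block_mxEdl ?block_mxEdr mxE /=;
    case: (inc i j); case: (s i j).
pose P := Bp *m Bp^T + Bm *m Bm^T; pose Q := Bp *m Bm^T + Bm *m Bp^T.
have -> : gram d (block_mx Bp Bm Bm Bp) = block_mx (P - d%:R%:M) Q Q (P - d%:R%:M).
  rewrite /gram tr_block_mx mulmx_block scalar_mx_block opp_block_mx add_block_mx.
  by rewrite !oppr0 !addr0 /P /Q [Bm *m Bm^T + _]addrC [Bm *m Bp^T + _]addrC.
rewrite char_poly_block_sym; congr (_ * _); congr char_poly.
  have -> : B = Bp + Bm.
    by apply/matrixP=> i j; rewrite !mxE expr0; case: inc; case: s; rewrite /= ?addr0 ?add0r.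
  rewrite /gram linearD /= mulmxDl !mulmxDr addrAC /P /Q; congr (_ - _).
  by rewrite (AC (2*2) ((1*3)*(4*2))).
have -> : S = Bp - Bm.
  by apply/matrixP=> i j; rewrite !mxE; case: inc; case: s;
    rewrite /= ?expr0 ?expr1 ?subr0 ?sub0r ?oppr0.
rewrite /gram linearB /= mulmxBl !mulmxBr addrAC /P /Q; congr (_ - _).
by rewrite opprB opprD (AC (2*2) ((1*3)*(2*4))).
Qed.

Hypothesis rdeg : forall i, #|[set j | inc i j]| = d.
Hypothesis cdeg : forall j, #|[set i | inc i j]| = r.
Hypothesis d1 : (1 < d)%N.
Hypothesis r1 : (1 < r)%N.
Hypothesis dr : (1 < d.-1 * r.-1)%N.
Hypothesis pos : positive_from (Num.sqrt (d%:R - 1) + Num.sqrt (r%:R - 1))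
  (char_poly (block_mx 0 S S^T 0)).

(** With q^2 = (d - 1)(r - 1) the gap is (q - 1)^2, and q > 1. *)
Lemma trivial_gt_ramanujan_bound : ramanujan_bound R d r < (r * d)%:R - d%:R.
Proof.
have dE : d%:R - 1 = d.-1%:R :> R by rewrite -(prednK (ltnW d1)) -natr1 addrK.
have rE : r%:R - 1 = r.-1%:R :> R by rewrite -(prednK (ltnW r1)) -natr1 addrK.
rewrite /ramanujan_bound natrM; set q := Num.sqrt _.
have q2 : q ^+ 2 = (d%:R - 1) * (r%:R - 1).
  by rewrite sqr_sqrtr // dE rE mulr_ge0 // ler0n.
have q1 : 1 < q.
  rewrite -(ltr_pXn2r (_ : 0 < 2)%N) ?nnegrE ?sqrtr_ge0 // expr1n q2 dE rE.
  by rewrite -natrM ltr1n.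
by nra.
Qed.

(* The difference of the indicator of a component of the lift on the two sheets is an
   eigenvector of the signed Gram matrix for the trivial eigenvalue, so it vanishes. *)
Lemma lift_connected :
  (forall u v, connect (collinear inc) u v) ->
  forall x y, connect (collinear inc') x y.
Proof.
move=> conn x0; pose C u := connect (collinear inc') x0 u.
have Cstep u u' w : inc' u w -> inc' u' w -> C u -> C u'.
  move=> h h' /connect_trans; apply; apply: connect1.
  by apply/existsP; exists w; rewrite h h'.
(* [C] is constant on the vertices of [w], and [cc w] is that value. [f] and [g] compare the two
   sheets, which a flag of sign -1 exchanges. *)
pose cc w := [exists u, inc' u w && C u].
have CC u w : inc' u w -> C u = cc w.
  move=> h; apply/idP/existsP => [Cu|[u' /andP[h' Cu']]]; first by exists u; rewrite h.
  exact: Cstep h' h Cu'.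
pose f i : R := (C (mk_sheet false i))%:R - (C (mk_sheet true i))%:R.
pose g j : R := (cc (mk_sheet false j))%:R - (cc (mk_sheet true j))%:R.
have Cij b i j : inc i j -> C (mk_sheet b i) = cc (mk_sheet (b (+) s i j) j).
  by move=> h; apply: CC; rewrite lift_inc_mk h addKb eqxx.
have fg i j : inc i j -> f i * (-1) ^+ s i j = g j.
  move=> h; rewrite /f /g !(Cij _ _ _ h); case: (s i j) => /=; last by rewrite expr0 mulr1.
  by rewrite expr1 mulrN1 opprB.
have gf i j : inc i j -> g j * (-1) ^+ s i j = f i.
  by move=> h; rewrite -(fg _ _ h) -mulrA -expr2 sqrr_sign mulr1.
pose w : 'rV[R]_n := \row_i f i.
have wS : w *m S = \row_j (r%:R * g j).
  apply/rowP=> j; rewrite !mxE.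
  transitivity (\sum_(i in [set i | inc i j]) g j); last by rewrite sumr_const cdeg mulr_natl.
  rewrite [RHS]big_mkcond; apply: eq_bigr => i _; rewrite !mxE inE.
  by case: ifP => h; rewrite ?mulr0 // fg.
have wSS : w *m gram d S = ((r * d)%:R - d%:R) *: w.
  rewrite /gram mulmxBr mul_mx_scalar scalerBl; congr (_ - _).
  rewrite mulmxA wS; apply/rowP=> i; rewrite !mxE.
  transitivity (\sum_(j in [set j | inc i j]) r%:R * f i).
    rewrite [RHS]big_mkcond; apply: eq_bigr => j _; rewrite !mxE inE.
    by case: ifP => h; rewrite ?mulr0 // -mulrA gf.
  by rewrite sumr_const rdeg -mulr_natr natrM; ring.
have w0 : w = 0.
  apply: contraTeq trivial_gt_ramanujan_bound => w0.
  by rewrite -leNgt (gram_eigenvalue_le d1 r1 pos wSS).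
have Cf i : C (mk_sheet false i) = C (mk_sheet true i).
  have /eqP := congr1 (fun z : 'rV[R]_n => z 0 i) w0; rewrite !mxE /f subr_eq0 eqr_nat.
  by case: (C (mk_sheet false i)); case: (C (mk_sheet true i)).
(* By [Cf] the component contains both lifts of a vertex or neither, so membership travels along a
   path of the base. *)
have Call i : C (mk_sheet false i).
  have [p pp ->] := connectP (conn (base x0) i).
  have : C (mk_sheet false (base x0)).
    have : C x0 by exact: connect0.
    by rewrite -{1}(mk_sheetK x0); case: (sheet x0); rewrite // -Cf.
  elim: p (base x0) pp => [//|v p IH] u /= /andP[/existsP[j /andP[uj vj]] pp] Cu.
  apply: IH pp _; rewrite (Cij _ _ _ vj).
  set b := _ (+) _; have <- : (b (+) s u j) (+) s u j = b by rewrite addbK.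
  rewrite -Cij //; case: (b (+) _); last exact: Cu.
  by rewrite -Cf.
move=> y; rewrite -/(C y) -(mk_sheetK y); case: (sheet y); last exact: Call.
by rewrite -Cf.
Qed.

End Lift.

Lemma ramanujan_lift_exists (R : realType) d r n m (inc : 'I_n -> 'I_m -> bool) :
  (1 < d)%N -> (1 < r)%N -> (1 < d.-1 * r.-1)%N ->
  ramanujan_incidence R d r inc ->
  exists s, ramanujan_incidence R d r (lift_inc inc s).
Proof.
move=> d1 r1 dr [rdeg cdeg cinj n0 conn [sp [spE spc]]].
have [s pos] := matching_signing_exists R rdeg cdeg d1 r1 dr.
exists s; split.
- by move=> u; rewrite lift_row_degree.
- by move=> w; rewrite lift_col_degree.
- apply: lift_col_inj => // j.
  have /card_gt0P [i0] : (0 < #|[set i | inc i j]|)%N by rewrite cdeg ltnW.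
  by rewrite inE; exists i0.
- by rewrite addn_gt0 n0.
- exact: (lift_connected rdeg cdeg d1 r1 dr pos conn).
have [t tE] := symmetric_real_rooted (gram_sym d (sign_mx R inc s)).
exists (sp ++ t); rewrite char_poly_gram_lift spE tE big_cat count_cat; split=> //.
rewrite (_ : count _ t = 0)%N ?addn0 //; apply/eqP; rewrite -leqn0 leqNgt -has_count.
apply/hasPn => x xt; rewrite -leNgt.
have : root (char_poly (gram d (sign_mx R inc s))) x by rewrite tE root_prod_XsubC.
rewrite -eigenvalue_root_char => /eigenvalueP[w wE w0].
exact: (gram_eigenvalue_le d1 r1 pos wE w0).
Qed.

(** * Designs *)

Lemma card_enum_val (T : finType) (Q : pred T) :
  #|[set j : 'I_#|T| | Q (enum_val j)]| = #|[set t | Q t]|.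
Proof.
rewrite -(card_imset _ enum_val_inj); apply: eq_card => t; apply/imsetP/idP.
  by case=> j; rewrite !inE => h ->.
by rewrite inE => h; exists (enum_rank t); rewrite ?inE enum_rankK.
Qed.

(** The matrix determinant lemma, multiplied by [a] to avoid division: [M] is eliminated once from
    the left and once from the right. *)
Lemma det_scalar_sub_rank1 (K : comNzRingType) n (a : K) (v : 'cV[K]_n) (w : 'rV[K]_n) :
  a * \det (a%:M - v *m w) = (a - (w *m v) 0 0) * a ^+ n.
Proof.
pose M : 'M[K]_(1 + n) := block_mx 1%:M w v a%:M.
have E1 : block_mx 1%:M 0 (- v) 1%:M *m M = block_mx 1%:M w 0 (a%:M - v *m w).
  rewrite mulmx_block !mul1mx !mulmx1 !mul0mx !addr0 mulNmx; congr block_mx.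
    by rewrite addrC subrr.
  by rewrite addrC.
have E2 : M *m block_mx a%:M 0 (- v) 1%:M = block_mx (a%:M - w *m v) w 0 a%:M.
  rewrite mulmx_block !mul1mx !mulmx1 !mulmx0 !add0r !mulmxN; congr block_mx.
  by rewrite mul_scalar_mx mul_mx_scalar subrr.
have /= := congr1 determinant E1; rewrite det_mulmx det_lblock det_ublock !det1 !mul1r => <-.
have /= := congr1 determinant E2; rewrite det_mulmx det_lblock det_ublock det1 mulr1.
by rewrite !det_scalar expr1 mulrC => ->; rewrite det_mx11 !mxE eqxx mulr1n.
Qed.

Lemma mul_sign_mx_tr (R : realType) n m (inc : 'I_n -> 'I_m -> bool) u v :
  let B := sign_mx R inc (fun _ _ => false) in
  (B *m B^T) u v = #|[set j | inc u j && inc v j]|%:R.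
Proof.
rewrite /= mxE -sum1_card natr_sum [RHS]big_mkcond; apply: eq_bigr => j _.
rewrite !mxE inE expr0; case: (inc u j); case: (inc v j); by rewrite /= ?mulr1 ?mulr0.
Qed.

Lemma gramE (R : realType) d n m (inc : 'I_n -> 'I_m -> bool) u v :
  (forall i, #|[set j | inc i j]| = d) ->
  gram d (sign_mx R inc (fun _ _ => false)) u v =
  if u == v then 0 else #|[set j | inc u j && inc v j]|%:R.
Proof.
move=> deg; rewrite /gram; set G := _ *m _.
rewrite mxE [G u v]mul_sign_mx_tr !mxE.
case: eqP => [->|_]; last by rewrite mulr0n subr0.
under eq_finset do rewrite andbb.
by rewrite deg mulr1n subrr.
Qed.

Lemma char_poly_complete (R : realType) n (c : R) : (0 < n)%N ->
  char_poly (\matrix_(i, j < n) if i == j then 0 else c) =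
  \prod_(x <- (c * n.-1%:R) :: nseq n.-1 (- c)) ('X - x%:P).
Proof.
case: n => // n _; rewrite big_cons big_nseq iter_mulr_1 /= polyCN opprK.
set a := 'X + c%:P; have a0 : a != 0 by rewrite /a -[c]opprK polyCN polyXsubC_eq0.
have E : char_poly (\matrix_(i, j < n.+1) if i == j then 0 else c) =
   \det (a%:M - (const_mx c%:P : 'cV_n.+1) *m (const_mx 1 : 'rV_n.+1)).
  congr (\det _); apply/matrixP=> i j; rewrite !mxE big_ord1 !mxE mulr1.
  by case: eqP => _ //; rewrite !mulr1n polyC0 subr0 /a addrK.
apply: (mulfI a0); rewrite E det_scalar_sub_rank1 exprS mulrCA; congr (_ * (_ * _)).
rewrite mxE; under eq_bigr do rewrite !mxE mul1r.
rewrite sumr_const card_ord /a mulrS opprD addrA addrK.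
by rewrite polyCM polyC_natr mulr_natr.
Qed.

Lemma ramanujan_bound_ge0 (R : realType) d r : (1 < r)%N -> 0 <= ramanujan_bound R d r.
Proof. by move=> r1; rewrite addr_ge0 ?mulr_ge0 ?sqrtr_ge0 // subr_ge0 ler_nat. Qed.

(** Any two points share [c] lines, so the adjacency matrix is c (J - I), with J the all-ones
    matrix. At most one eigenvalue is positive while the bound is nonnegative, and [c > 0] makes all
    points collinear in one step. *)
Lemma design_ramanujan (R : realType) (P L : finType) (inc : P -> L -> bool) d r c :
  (forall p, #|[set l | inc p l]| = d) -> (forall l, #|[set p | inc p l]| = r) ->
  (forall l l', (forall p, inc p l = inc p l') -> l = l') ->
  (forall p q, p != q -> #|[set l | inc p l && inc q l]| = c) ->
  (0 < #|P|)%N -> (0 < c)%N -> (1 < r)%N ->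
  ramanujan_incidence R d r (fun (i : 'I_#|P|) (j : 'I_#|L|) => inc (enum_val i) (enum_val j)).
Proof.
move=> rdeg cdeg inj codeg P0 c0 r1; set inc' := fun _ _ => _.
have rdeg' i : #|[set j | inc' i j]| = d.
  by rewrite -(rdeg (enum_val i)); exact: (card_enum_val (inc (enum_val i))).
have codeg' i i' : i != i' -> #|[set j | inc' i j && inc' i' j]| = c.
  move=> ne; rewrite -(codeg (enum_val i) (enum_val i')) ?(inj_eq enum_val_inj) //.
  exact: (card_enum_val (fun l => inc (enum_val i) l && inc (enum_val i') l)).
split=> //.
- move=> j; rewrite -(cdeg (enum_val j)).
  exact: (card_enum_val (inc^~ (enum_val j))).
- move=> j j' E; apply: enum_val_inj; apply: inj => p.
  by have := E (enum_rank p); rewrite /inc' enum_rankK.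
- move=> u v; have [->|uv] := eqVneq u v; first exact: connect0.
  have /card_gt0P [j] : (0 < #|[set j | inc' u j && inc' v j]|)%N by rewrite codeg'.
  by rewrite inE => h; apply: connect1; apply/existsP; exists j.
exists ((c%:R * #|P|.-1%:R) :: nseq #|P|.-1 (- c%:R)); split.
  rewrite -char_poly_complete //; congr char_poly; apply/matrixP=> i j.
  by rewrite gramE // mxE; case: eqP => // /eqP /codeg' ->.
rewrite /= count_nseq [_ < - _]ltNge (le_trans _ (ramanujan_bound_ge0 R d r1)) ?oppr_le0 //.
by case: (_ < _).
Qed.

Lemma complete_design_ramanujan (R : realType) d : (1 < d)%N ->
  exists n m (inc : 'I_n -> 'I_m -> bool), ramanujan_incidence R d d inc.
Proof.
move=> d1; do 3!eexists.
(* Edge [j] is the complement of point [j]; two points share the edges whose missing point is one of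
   the other [d - 1]. *)
apply: (@design_ramanujan _ _ _ (fun i j : 'I_d.+1 => i != j) d d d.-1) => //.
- move=> i; rewrite -[RHS](_ : #|[set~ i]| = _); last by rewrite cardsC1 card_ord.
  by apply: eq_card => j; rewrite !inE eq_sym.
- move=> i; rewrite -[RHS](_ : #|[set~ i]| = _); last by rewrite cardsC1 card_ord.
  by apply: eq_card => j; rewrite !inE.
- by move=> j j' /(_ j); rewrite eqxx => /esym/negbFE/eqP.
- move=> i j ij; have := cardsC [set i; j]; rewrite cards2 ij card_ord => h.
  have -> : [set l | (i != l) && (j != l)] = ~: [set i; j].
    by apply/setP=> l; rewrite !inE negb_or !(eq_sym l).
  by apply: (@addnI 2); rewrite [LHS]h -[in LHS](prednK (ltnW d1)).
- by rewrite card_ord.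
- by rewrite -ltnS prednK // ltnW.
Qed.

Section AffinePlane.
Variable F : finFieldType.

Definition on_line (p : F * F) (l : (F * F) + F) : bool :=
  match l with
  | inl mb => p.2 == mb.1 * p.1 + mb.2
  | inr c => p.1 == c
  end.

Lemma affine_point_degree p : #|[set l | on_line p l]| = #|F|.+1.
Proof.
(* One line through [p] for each slope, and [None] for the vertical one. *)
pose h (o : option F) : (F * F) + F :=
  if o is Some m then inl (m, p.2 - m * p.1) else inr p.1.
have hI : injective h by move=> [m|] [m'|] //= [] ->.
rewrite -card_option -cardsT -(card_imset _ hI); apply: eq_card => l.
rewrite inE; apply/idP/imsetP => [|[[m|] _ ->] /=]; rewrite ?subrKC ?eqxx //.
  case: l => [[m b]|c] /= /eqP E; last by exists None; rewrite ?inE // /h E.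
  by exists (Some m); rewrite ?inE // /h E addrC addKr.
Qed.

Lemma affine_line_degree l : #|[set p | on_line p l]| = #|F|.
Proof.
case: l => [[m b]|c] /=.
  have hI : injective (fun x : F => (x, m * x + b)) by move=> x y [].
  rewrite -cardsT -(card_imset _ hI); apply: eq_card => -[x y].
  rewrite inE /=; apply/eqP/imsetP => [->|[z _ [-> ->]] //]; by exists x.
have hI : injective (fun y : F => (c, y)) by move=> x y [].
rewrite -cardsT -(card_imset _ hI); apply: eq_card => -[x y].
rewrite inE /=; apply/eqP/imsetP => [->|[z _ [-> _]] //]; by exists y.
Qed.

Lemma affine_codegree p q : p != q -> #|[set l | on_line p l && on_line q l]| = 1%N.
Proof.
case: p q => [x y] [x' y'] ne; have [xx|xx] := eqVneq x x'.
  have yy : y != y' by apply: contraNneq ne => ->; rewrite xx.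
  rewrite -(cards1 (inr x : (F * F) + F)); apply: eq_card => -[[m b]|c]; rewrite !inE /=.
    rewrite -xx; apply/negP=> /andP[/eqP E /eqP E'].
    by rewrite E E' eqxx in yy.
  by rewrite -xx andbb eq_sym.
pose m := (y - y') / (x - x').
have x0 : x - x' != 0 by rewrite subr_eq0.
rewrite -(cards1 (inl (m, y - m * x) : (F * F) + F)).
apply: eq_card => -[[m1 b]|c]; rewrite !inE /=; last first.
  by apply/negP=> /andP[/eqP <-]; rewrite eq_sym (negPf xx).
apply/andP/eqP => [[/eqP E /eqP E']|[-> ->]].
  have mE : m1 = m by rewrite /m E E'; field.
  by rewrite -mE E addrC addKr.
by split; apply/eqP; rewrite /m; field.
Qed.

Lemma affine_line_inj l l' : (forall p, on_line p l = on_line p l') -> l = l'.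
Proof.
case: l l' => [[m b]|c] [[m' b']|c'] /= E.
- have := E (0, b); rewrite /= !mulr0 !add0r eqxx => /esym/eqP bb.
  have := E (1, m + b); rewrite /= !mulr1 eqxx => /esym/eqP.
  by rewrite bb => /addIr ->.
- have := E (0, b); rewrite /= mulr0 add0r eqxx => /esym/eqP h0.
  have := E (1, m + b); rewrite /= mulr1 eqxx => /esym/eqP.
  by rewrite -h0 => /eqP; rewrite oner_eq0.
- have := E (0, b'); rewrite /= mulr0 add0r eqxx => /eqP h0.
  have := E (1, m' + b'); rewrite /= mulr1 eqxx => /eqP.
  by rewrite -h0 => /eqP; rewrite oner_eq0.
- by have := E (c, 0); rewrite /= eqxx => /esym/eqP ->.
Qed.

Lemma affine_plane_ramanujan (R : realType) :
  exists n m (inc : 'I_n -> 'I_m -> bool), ramanujan_incidence R #|F|.+1 #|F| inc.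
Proof.
do 3!eexists; apply: (@design_ramanujan _ _ _ on_line _ _ 1) => //.
- exact: affine_point_degree.
- exact: affine_line_degree.
- exact: affine_line_inj.
- exact: affine_codegree.
- by apply/card_gt0P; exists (0, 0).
- exact: card_finNzRing_gt1.
Qed.

End AffinePlane.

(** * From incidence structures to hypergraphs *)

Definition hypergraph_of n m (inc : 'I_n -> 'I_m -> bool) : hypergraph :=
  @Hypergraph 'I_n [set [set i | inc i j] | j : 'I_m].

(** An entry above [b] at a positive index would put the head above [b] as well, making two. *)
Lemma sorted_count_le (R : realType) (b : R) (s : seq R) i :
  sorted >=%R s -> (count (fun x => b < x)%R s <= 1)%N -> (0 < i < size s)%N -> s`_i <= b.
Proof.
case: s => [|x s]; first by rewrite andbF.
case: i => // i /= srt cnt; rewrite ltnS => ilt; rewrite leNgt; apply/negP=> bi.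
have is_ : s`_i \in s by exact: mem_nth.
have xi : s`_i <= x.
  by have /allP/(_ _ is_) := order_path_min (rev_trans le_trans) srt.
move: cnt; rewrite (lt_le_trans bi xi) /= add1n ltnS leqn0 => /eqP h.
have : has (fun x => b < x) s by apply/hasP; exists s`_i.
by rewrite has_count h.
Qed.

(** [adjacency] is indexed by [#|'I_n|], which equals [n] only through a proof, so the matrix has to
    be transported. *)
Lemma char_poly_enum (R : comNzRingType) n (G : 'M[R]_n) :
  char_poly (\matrix_(i, j < #|'I_n|) G (enum_val i) (enum_val j)) = char_poly G.
Proof.
have gen k (e : k = n) :
    char_poly (\matrix_(i, j < k) G (cast_ord e i) (cast_ord e j)) = char_poly G.
  case: n / e in G *; congr char_poly; apply/matrixP=> i j.
  by rewrite mxE !cast_ord_id.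
rewrite -(gen _ (card_ord n)); congr char_poly; apply/matrixP=> i j.
by rewrite !mxE !enum_val_ord.
Qed.

Lemma ramanujan_hypergraph (R : realType) d r n m (inc : 'I_n -> 'I_m -> bool) :
  ramanujan_incidence R d r inc -> right_sided_ramanujan R d r (hypergraph_of inc).
Proof.
case=> rdeg cdeg inj n0 conn [s [sE cnt]].
have colI : injective (fun j => [set i | inc i j]).
  by move=> j j' /setP E; apply: inj => i; have := E i; rewrite !inE.
have card_edges (Q : pred {set 'I_n}) :
    #|[set e in edges (hypergraph_of inc) | Q e]| = #|[set j | Q [set i | inc i j]]|.
  rewrite -(card_imset _ colI); apply: eq_card => e; rewrite !inE.
  apply/andP/imsetP => [[/imsetP[j _ ->] Qj]|[j]]; first by exists j; rewrite ?inE.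
  by rewrite inE => Qj ->; split=> //; apply/imsetP; exists j.
split.
- split; first by rewrite card_ord.
  move=> u v; have := conn u v; congr is_true; apply: eq_connect => x y /=.
  apply/existsP/existsP => [[j /andP[xj yj]]|[e /andP[/imsetP[j _ ->]]]].
    by exists [set i | inc i j]; rewrite !inE xj yj !andbT; apply/imsetP; exists j.
  by rewrite !inE; exists j.
- split=> [e /imsetP[j _ ->]|v]; first exact: cdeg.
  by rewrite card_edges -(rdeg v); apply: eq_card => j; rewrite !inE.
exists (sort >=%R s); split; last first.
  move=> i; apply: sorted_count_le; first exact: (sort_sorted (@ge_total _ R)).
  by rewrite (permP (permEl (perm_sort _ _))).
split; first exact: (sort_sorted (@ge_total _ R)).
rewrite (perm_big s) ?(permEl (perm_sort _ _)) //= -sE -[RHS]char_poly_enum.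
congr char_poly; apply/matrixP=> i j; rewrite [LHS]mxE [RHS]mxE gramE // (inj_eq enum_val_inj).
case: ifP => // _; congr (_%:R); rewrite /codegree card_edges.
by apply: eq_card => l; rewrite !inE.
Qed.

(** Each lift doubles the number of vertices, so different levels of the tower have different
    sizes. *)
Lemma infinitely_many_ramanujan (R : realType) d r n m (inc : 'I_n -> 'I_m -> bool) :
  (1 < d)%N -> (1 < r)%N -> (1 < d.-1 * r.-1)%N ->
  ramanujan_incidence R d r inc -> infinitely_many (right_sided_ramanujan R d r).
Proof.
move=> d1 r1 dr ram.
have tower k : exists m' (inc' : 'I_(n * 2 ^ k) -> 'I_m' -> bool),
    ramanujan_incidence R d r inc'.
  elim: k => [|k [m' [inc' ram']]]; first by rewrite muln1; exists m, inc.
  have [s rams] := ramanujan_lift_exists d1 r1 dr ram'.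
  by rewrite expnS mulnCA mul2n -addnn; do 2!eexists; exact: rams.
have /boolp.choice[F FP] k : exists H : hypergraph,
    right_sided_ramanujan R d r H /\ #|vertex H| = (n * 2 ^ k)%N.
  have [m' [inc' /ramanujan_hypergraph ram']] := tower k.
  by exists (hypergraph_of inc'); split=> //; rewrite card_ord.
exists F; split=> [k|k l kl [f [bij_f _]]]; first by case: (FP k).
apply: kl; have := bij_eq_card bij_f; have [_ ->] := FP k; have [_ ->] := FP l.
move/eqP; rewrite eqn_pmul2l ?(inc_nonempty ram) // eqn_exp2l // => /eqP //.
Qed.

Theorem theorem1p7 (R : realType) :
  (forall d : nat, (3 <= d)%N ->
     infinitely_many (fun H : hypergraph => right_sided_ramanujan R d d H)) /\
  (forall d : nat, prime_power d ->
     infinitely_many (fun H : hypergraph => right_sided_ramanujan R d.+1 d H)).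
Proof.
split=> [d d3|_ [p [k [pp k0 ->]]]].
  have d1 : (1 < d)%N by exact: ltnW.
  have [n [m [inc ram]]] := complete_design_ramanujan R d1.
  apply: infinitely_many_ramanujan ram => //.
  (* The product is (d - 1)^2, which would not exceed 1 for [d = 2]. *)
  by case: d d3 {d1} => [|[|[|d]]].
have [F _ <-] := pPrimePowerField pp k0.
have [n [m [inc ram]]] := affine_plane_ramanujan F R.
have F1 := card_finNzRing_gt1 F.
apply: infinitely_many_ramanujan ram => //; first exact: ltnW.
(* The product is q (q - 1) with q the order of [F], and equals 2 already at q = 2. *)
by move: #|F| F1 => [|[|q]] // _; rewrite /= mulnS.
Qed.
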